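(* Let $f\in L_1$. (a) If $\mathcal{F}_o f\in L_1$, then $f(x)=(\mathcal{F}_o^2 f)(-x)$ for almost every $x\in\mathbb{R}^n$. (b) If $f\mathcal{F}_o\in L_1$, then $f(x)=(f\mathcal{F}_o^2)(-x)$ for almost every $x\in\mathbb{R}^n$. Moreover, $\mathcal{F}_o^2 f=f\mathcal{F}_o^2$ (when both $\mathcal{F}_o f$ and $f\mathcal{F}_o$ belong to $L_1$, so that both sides are defined).
   Context: $\mathcal{G}_{2n}$ is the real Clifford algebra generated by an orthonormal basis $e_1,\dots,e_n,e'_1,\dots,e'_n$ of $\mathbb{R}^{2n}$, with $v^2=v\cdot v$ for all vectors $v$ (so basis vectors square to $1$ and distinct basis vectors anticommute). The norm is $|A|^2=\sum_I\alpha_I^2$ for $A=\sum_I\alpha_I e_I$ in the standard basis of ordered products of basis vectors. Put $B_i=e_ie'_i$; then $B_i^2=-1$ and $B_iB_j=B_jB_i$. The measure is $dm(x)=(2\pi)^{-n/2}dx$ on $\mathbb{R}^n$, with $dx$ Lebesgue measure; $L_1$ is the space of functions $f\colon\mathbb{R}^n\to\mathcal{G}_{2n}$ integrable with respect to $m$. With $I(x,y)=\sum_{i=1}^nB_ix_iy_i$ for $x,y\in\mathbb{R}^n$, the left and right Clifford-Fourier transforms are $$(\mathcal{F}_o f)(y)=\int_{\mathbb{R}^n}e^{-I(x,y)}f(x)\,dm(x),\qquad (f\mathcal{F}_o)(y)=\int_{\mathbb{R}^n}f(x)e^{-I(x,y)}\,dm(x),$$ and $\mathcal{F}_o^2 f=\mathcal{F}_o(\mathcal{F}_o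 f)$, $f\mathcal{F}_o^2=(f\mathcal{F}_o)\mathcal{F}_o$. *)

(* Defs.v *)
From HB Require Import structures.
From mathcomp Require Import all_boot all_order all_algebra.
From mathcomp Require Import ring.
From mathcomp Require Import all_classical all_reals all_analysis.
From mathcomp Require Import measurable_realfun.

Set Implicit Arguments.
Unset Strict Implicit.
Unset Printing Implicit Defensive.
Import Order.TTheory GRing.Theory Num.Theory.
Import numFieldNormedType.Exports.
Local Open Scope classical_set_scope.
Local Open Scope ring_scope.

Definition symd m (S T : {set 'I_m}) : {set 'I_m} := (S :\: T) :|: (T :\: S).

Section Symd.
Variable m : nat.
Implicit Types S T U : {set 'I_m}.

Lemma in_symd S T i : (i \in symd S T) = (i \in S) (+) (i \in T).
Proof. by rewrite !inE; case: (i \in S); case: (i \in T). Qed.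

Lemma symdA : associative (@symd m).
Proof. by move=> S T U; apply/setP => i; rewrite !in_symd addbA. Qed.

Lemma symdC : commutative (@symd m).
Proof. by move=> S T; apply/setP => i; rewrite !in_symd addbC. Qed.

Lemma symd0S S : symd finset.set0 S = S.
Proof. by apply/setP => i; rewrite in_symd inE. Qed.

Lemma symdSS S : symd S S = finset.set0.
Proof. by apply/setP => i; rewrite in_symd addbb inE. Qed.

Lemma symdK S : cancel (symd S) (symd S).
Proof. by move=> T; rewrite symdA symdSS symd0S. Qed.

End Symd.

(* Clifford algebra of the Euclidean space R^m: an element is given by its
   coordinates in the basis of the ordered products e_S = e_i1 ... e_ik, where
   S = {i1 < ... < ik}.  The type is kept apart from {ffun _ -> R}, whose ring
   structure is pointwise. *)
Definition clifford (R : realType) (m : nat) : Type := {ffun {set 'I_m} -> R}.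
HB.instance Definition _ (R : realType) m :=
  GRing.Lmodule.copy (clifford R m) {ffun {set 'I_m} -> R^o}.

Section CliffordRing.
Variables (R : realType) (m : nat).
Implicit Types (S T U : {set 'I_m}) (A B C : clifford R m).

Definition ccoef A S : R := (A : {ffun {set 'I_m} -> R}) S.

Definition blade S : clifford R m := [ffun T => (T == S)%:R].

(* e_S e_T = csign S T e_(symd S T): sorting the concatenated product takes one
   transposition of anticommuting vectors for each i \in S and j \in T with
   j < i, and then e_i e_i = 1 removes the common factors. *)
Definition csign S T : R := \prod_(i in S) \prod_(j in T | (j < i)%N) -1.

Definition cliff_mul A B : clifford R m :=
  [ffun U => \sum_(S : {set 'I_m})
     csign S (symd S U) * ccoef A S * ccoef B (symd S U)].

Lemma cliffP A B : (forall S, ccoef A S = ccoef B S) <-> A = B.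
Proof. by split=> [h|->//]; apply/ffunP => S; exact: h. Qed.

Lemma ccoefE (f : {set 'I_m} -> R) S :
  ccoef ([ffun U => f U] : clifford R m) S = f S.
Proof. by rewrite /ccoef ffunE. Qed.

Lemma ccoefD A B S : ccoef (A + B) S = ccoef A S + ccoef B S.
Proof. by rewrite /ccoef ffunE. Qed.

Lemma ccoefZ a A S : ccoef (a *: A) S = a * ccoef A S.
Proof. by rewrite /ccoef ffunE. Qed.

Lemma ccoef_blade S T : ccoef (blade S) T = (T == S)%:R.
Proof. by rewrite /ccoef ffunE. Qed.

Lemma prod_symd (F : 'I_m -> R) S T : (forall i, F i * F i = 1) ->
  \prod_(i in symd S T) F i = \prod_(i in S) F i * \prod_(i in T) F i.
Proof.
move=> F1; rewrite big_mkcond [in RHS]big_mkcond [X in _ * X]big_mkcond /=.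
rewrite -big_split; apply: eq_bigr => i _; rewrite in_symd.
by case: (i \in S); case: (i \in T); rewrite /= ?F1 ?mulr1 ?mul1r.
Qed.

Lemma prodN1_sq (P : pred 'I_m) :
  (\prod_(j | P j) -1 : R) * (\prod_(j | P j) -1) = 1.
Proof. by rewrite -big_split /= big1 // => j _; rewrite mulrNN mulr1. Qed.

Lemma csign_symdl S T U : csign (symd S T) U = csign S U * csign T U.
Proof. by apply: prod_symd => i; exact: prodN1_sq. Qed.

Lemma csignE S T :
  csign S T = \prod_(j in T) \prod_(i in S | (j < i)%N) -1.
Proof.
rewrite /csign (exchange_big_dep (mem T)) //=; last by move=> i j _ /andP[].
by apply: eq_bigr => j Tj; apply: eq_bigl => i; rewrite Tj.
Qed.

Lemma csign_symdr S T U : csign S (symd T U) = csign S T * csign S U.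
Proof. by rewrite !csignE; apply: prod_symd => i; exact: prodN1_sq. Qed.

Lemma csign0l S : csign finset.set0 S = 1.
Proof. by rewrite /csign big1 // => i; rewrite inE. Qed.

Lemma csign0r S : csign S finset.set0 = 1.
Proof. by rewrite csignE big1 // => i; rewrite inE. Qed.

Lemma cliff_mulA : associative cliff_mul.
Proof.
move=> A B C; apply/cliffP => V; rewrite !ccoefE.
under eq_bigr do rewrite ccoefE mulr_sumr.
under [RHS]eq_bigr do rewrite ccoefE mulr_sumr mulr_suml.
rewrite [RHS]exchange_big; apply: eq_bigr => S _ /=.
rewrite [RHS](reindex_inj (can_inj (symdK S))); apply: eq_bigr => T _ /=.
rewrite symdK; set W := symd (symd S T) V.
have -> : symd T (symd S V) = W by rewrite /W symdA (symdC T S).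
have {1}-> : symd S V = symd T W.
  by rewrite /W (symdC S T) -symdA symdK.
rewrite csign_symdr csign_symdl; ring.
Qed.

Lemma cliff_mul1l : left_id (blade finset.set0) cliff_mul.
Proof.
move=> A; apply/cliffP => U; rewrite ccoefE (bigD1 finset.set0) //=.
rewrite symd0S csign0l ccoef_blade eqxx !mul1r big1 ?addr0 // => S /negPf S0.
by rewrite ccoef_blade S0 mulr0 mul0r.
Qed.

Lemma cliff_mul1r : right_id (blade finset.set0) cliff_mul.
Proof.
move=> A; apply/cliffP => U; rewrite ccoefE (bigD1 U) //=.
rewrite symdSS csign0r ccoef_blade eqxx mul1r mulr1 big1 ?addr0 // => S SU.
rewrite ccoef_blade; case: eqP => [SU0|]; last by rewrite mulr0.
by case/eqP: SU; rewrite -[U](symdK S) SU0 symdC symd0S.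
Qed.

Lemma cliff_mulDl : left_distributive cliff_mul +%R.
Proof.
move=> A B C; apply/cliffP => U; rewrite ccoefD !ccoefE -big_split.
by apply: eq_bigr => S _; rewrite ccoefD mulrDr mulrDl.
Qed.

Lemma cliff_mulDr : right_distributive cliff_mul +%R.
Proof.
move=> A B C; apply/cliffP => U; rewrite ccoefD !ccoefE -big_split.
by apply: eq_bigr => S _; rewrite ccoefD mulrDr.
Qed.

Lemma blade0_neq0 : blade finset.set0 != 0.
Proof.
apply/eqP => /(congr1 (fun A => ccoef A finset.set0))/eqP.
by rewrite ccoef_blade eqxx /ccoef ffunE oner_eq0.
Qed.

HB.instance Definition _ := GRing.Zmodule_isNzRing.Build (clifford R m)
  cliff_mulA cliff_mul1l cliff_mul1r cliff_mulDl cliff_mulDr blade0_neq0.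

Lemma cliff_scalerAl (a : R) A B : a *: (A * B) = a *: A * B.
Proof.
apply/cliffP => U; rewrite ccoefZ !ccoefE mulr_sumr.
by apply: eq_bigr => S _; rewrite ccoefZ; ring.
Qed.

Lemma cliff_scalerAr (a : R) A B : a *: (A * B) = A * (a *: B).
Proof.
apply/cliffP => U; rewrite ccoefZ !ccoefE mulr_sumr.
by apply: eq_bigr => S _; rewrite ccoefZ; ring.
Qed.

HB.instance Definition _ :=
  GRing.Lmodule_isLalgebra.Build R (clifford R m) cliff_scalerAl.
HB.instance Definition _ :=
  GRing.Lalgebra_isAlgebra.Build R (clifford R m) cliff_scalerAr.

Lemma blade0 : blade finset.set0 = 1. Proof. by []. Qed.

Lemma bladeM S T : blade S * blade T = csign S T *: blade (symd S T).
Proof.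
apply/cliffP => U; rewrite ccoefZ !ccoefE (bigD1 S) //= !ccoef_blade eqxx mulr1.
rewrite big1 ?addr0 => [|V /negPf VS]; last first.
  by rewrite ccoef_blade VS mulr0 mul0r.
have -> : (symd S U == T) = (U == symd S T).
  by rewrite -(inj_eq (can_inj (symdK S))) symdK.
by case: eqP => [->|]; rewrite ?symdK // !mulr0.
Qed.

Definition gen (i : 'I_m) : clifford R m := blade [set i]%SET.

Lemma genK i : gen i * gen i = 1.
Proof.
rewrite /gen bladeM symdSS /csign big_set1 big1 ?scale1r // => j /andP[].
by rewrite inE => /eqP ->; rewrite ltnn.
Qed.

Lemma gen_anti i j : i != j -> gen i * gen j = - (gen j * gen i).
Proof.
move=> ij; rewrite /gen !bladeM (symdC [set j]%SET) -scaleNr; congr (_ *: _).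
have gE (k l : 'I_m) :
    csign [set k]%SET [set l]%SET = if (l < k)%N then -1 else 1 :> R.
  rewrite /csign big_set1 big_mkcondr /=.
  by rewrite (eq_bigl (mem [set l]%SET)) ?big_set1.
by rewrite !gE; case: (ltngtP j i) ij => //; rewrite ?opprK // => /val_inj ->;
   rewrite eqxx.
Qed.

Lemma cliff_sumE A : A = \sum_S ccoef A S *: blade S.
Proof.
apply/cliffP => U; rewrite /ccoef sum_ffunE (bigD1 U) //= big1 => [|S SU].
  by rewrite addr0 -[RHS]/(ccoef (_ *: _) U) ccoefZ ccoef_blade eqxx mulr1.
rewrite -[LHS]/(ccoef (_ *: _) U) ccoefZ ccoef_blade eq_sym (negPf SU).
exact: mulr0.
Qed.

Lemma gen_blade (i : 'I_m) T : (forall j, j \in T -> (i < j)%N) ->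
  gen i * blade T = blade (i |: T)%SET.
Proof.
move=> iT; rewrite /gen bladeM.
have -> : symd [set i]%SET T = (i |: T)%SET.
  apply/setP => j; rewrite in_symd !inE; case: eqP => [->|//].
  by case: (boolP (i \in T)) => // /iT; rewrite ltnn.
rewrite /csign big_set1 big1 ?scale1r // => j /andP[/iT ij].
by rewrite ltnNge ltnW.
Qed.

Lemma bladeE S : blade S = \prod_(i <- enum S) gen i.
Proof.
have: sorted (relpre val ltn) (enum S).
  rewrite /(enum _) -enumT; apply: sorted_filter.
    by move=> i j k; exact: ltn_trans.
  by rewrite -sorted_map val_enum_ord iota_ltn_sorted.
have {2}-> : S = [set i in enum S]%SET by apply/setP => i; rewrite inE mem_enum.
elim: (enum S) => [_|i s ih] /=.
  by rewrite big_nil -blade0; congr blade; apply/setP => i; rewrite !inE.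
rewrite (path_sortedE (fun _ _ _ => @ltn_trans _ _ _)) => /andP[/allP is_ s_s].
rewrite big_cons -ih // gen_blade => [|j]; last by rewrite inE => /is_.
by congr blade; apply/setP => j; rewrite !inE.
Qed.

Lemma vec_sq (v : 'I_m -> R) :
  (\sum_i v i *: gen i) ^+ 2 = (\sum_i v i * v i)%:A.
Proof.
have vE i j : v i *: gen i * (v j *: gen j) = (v i * v j) *: (gen i * gen j).
  by rewrite -scalerAl -scalerAr scalerA.
apply: (@scalerI _ _ 2); first by rewrite pnatr_eq0.
rewrite expr2 {1}mulr_suml.
under eq_bigr do rewrite mulr_sumr.
rewrite scaler_nat mulr2n {2}exchange_big -big_split /=.
rewrite scaler_suml scaler_sumr; apply: eq_bigr => i _.
rewrite -big_split (bigD1 i) //= big1 => [|j ij].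
  by rewrite addr0 !vE genK -scalerDl scalerA mulr_natl mulr2n.
rewrite !vE (gen_anti ij) mulrC scalerN; exact: subrr.
Qed.

End CliffordRing.

Section FourierSetting.
Variable R : realType.

(* R^n with the product Borel sigma-algebra. *)
Definition rspace n := n.-tuple (measurableTypeR R).

Definition tcons n (p : measurableTypeR R * rspace n) : rspace n.+1 :=
  [tuple of p.1 :: p.2].

Lemma measurable_tcons n : measurable_fun [set: _] (@tcons n).
Proof. exact: measurable_cons. Qed.

Section Step.
Variables (n : nat) (mu : {sigma_finite_measure set (rspace n) -> \bar R}).

Definition lebesgueS : set (rspace n.+1) -> \bar R :=
  pushforward (@lebesgue_measure R \x mu)%E (@tcons n).

Let lebesgueS0 : lebesgueS set0 = 0%E.
Proof. by rewrite /lebesgueS /pushforward preimage_set0 measure0. Qed.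

Let lebesgueS_ge0 A : (0 <= lebesgueS A)%E.
Proof. by rewrite /lebesgueS /pushforward measure_ge0. Qed.

Let measurable_pre A : measurable A -> measurable (@tcons n @^-1` A).
Proof.
by move=> mA; rewrite -[X in measurable X]setTI; exact: measurable_tcons.
Qed.

Let lebesgueS_sigma_additive : semi_sigma_additive lebesgueS.
Proof.
move=> F mF tF mUF; rewrite /lebesgueS /pushforward preimage_bigcup.
apply: measure_semi_sigma_additive.
- by move=> k; exact: measurable_pre.
- apply/trivIsetP => /= i j _ _ ij; rewrite -preimage_setI.
  by move/trivIsetP : tF => /(_ _ _ _ _ ij) ->//; rewrite preimage_set0.
- by rewrite -preimage_bigcup; exact: measurable_pre.
Qed.

HB.instance Definition _ := isMeasure.Build _ _ _ lebesgueS
  lebesgueS0 lebesgueS_ge0 lebesgueS_sigma_additive.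

Let lebesgueS_sigma_finite : sigma_finite setT lebesgueS.
Proof.
have /sigma_finiteP[F [TF ndF mF]] := sigma_finiteT (@lebesgue_measure R).
have /sigma_finiteP[G [TG ndG mG]] := sigma_finiteT mu.
pose split (x : rspace n.+1) := (thead x, [tuple of behead x] : rspace n).
have splitK : cancel split (@tcons n) by move=> x; rewrite [RHS]tuple_eta.
have rconsK : cancel (@tcons n) split.
  by move=> [a x]; rewrite /split theadE; congr pair; exact/val_inj.
have msplit : measurable_fun [set: rspace n.+1] split.
  apply/measurable_fun_pairP; split; last exact: measurable_behead.
  exact: measurable_tnth.
exists (fun k => split @^-1` (F k `*` G k)).
  rewrite -preimage_bigcup -[LHS](preimage_setT split); congr (_ @^-1` _).
  apply/seteqP; split=> [[a x] _|//].
  have [k _ Fka] : (\bigcup_i F i) a by rewrite -TF.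
  have [l _ Glx] : (\bigcup_i G i) x by rewrite -TG.
  exists (maxn k l) => //; split.
  - by move: a Fka; exact/subsetPset/ndF/leq_maxl.
  - by move: x Glx; exact/subsetPset/ndG/leq_maxr.
move=> k; have [[mFk Fk] [mGk Gk]] := (mF k, mG k); split.
  by rewrite -[X in measurable X]setTI; apply: msplit => //; exact: measurableX.
rewrite /lebesgueS /pushforward (_ : _ @^-1` _ = F k `*` G k).
  by rewrite product_measure1E// lte_mul_pinfty// ge0_fin_numE.
rewrite -comp_preimage (_ : _ \o _ = id) ?preimage_id //.
exact/funext/rconsK.
Qed.

HB.instance Definition _ :=
  Measure_isSigmaFinite.Build _ _ _ lebesgueS lebesgueS_sigma_finite.

End Step.

Fixpoint lebesgue n : {sigma_finite_measure set (rspace n) -> \bar R} :=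
  if n is n'.+1 then lebesgueS (lebesgue n') else \d_ ([tuple] : rspace 0).

Lemma lebesgue_box n (A : 'I_n -> set (measurableTypeR R)) :
  (forall i, measurable (A i)) ->
  lebesgue n [set x | forall i, A i (tnth x i)] =
  (\prod_(i < n) lebesgue_measure (A i))%E.
Proof.
elim: n A => [|n ih] A mA.
  by rewrite big_ord0 /= diracE mem_set // => -[].
pose P := [set x : rspace n | forall i, A (lift ord0 i) (tnth x i)].
have mP : measurable P.
  have -> : P = \bigcap_(i in [set: 'I_n]) ((@tnth _ _)^~ i @^-1` A (lift ord0 i)).
    by apply/seteqP; split=> x Px i => [_|]; exact: Px.
  apply: fin_bigcap_measurable => // i _; rewrite -[X in measurable X]setTI.
  exact: measurable_tnth.
rewrite big_ord_recl -(ih (fun i => A (lift ord0 i)) (fun i => mA _)) -/P.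
rewrite -product_measure1E //= /lebesgueS /pushforward; congr (_ _).
apply/seteqP; split=> [[a x] Ax|[a x] [Aa Px] i] /=.
  by split=> [|i]; [exact: (Ax ord0)|have := Ax (lift ord0 i); rewrite tnthS].
by case: (unliftP ord0 i) => [j ->|-> //]; rewrite tnthS; exact: Px.
Qed.

Definition fmeas n : {measure set (rspace n) -> \bar R} :=
  mscale (NngNum (powR_ge0 (2 * pi) (- (n%:R / 2)))) (lebesgue n).

(* Lebesgue measurability: preimages of Borel sets belong to the completion of
   the Borel sigma-algebra.  The library integral of a nonnegative function is a
   supremum over the Borel simple functions below it, so on this class it agrees
   with the integral with respect to the completed measure. *)
Definition lebesgue_measurable n (g : rspace n -> R) : Prop :=
  forall B : set (measurableTypeR R), measurable B ->
    completed_algebra_gen (lebesgue n) (g @^-1` B).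

Definition cnorm m (A : clifford R m) : R :=
  Num.sqrt (\sum_S ccoef A S ^+ 2).

(* The exponential series; coordinatewise convergence is convergence for
   cnorm. *)
Definition cexp m (A : clifford R m) : clifford R m :=
  [ffun S => limn [series ccoef (k`!%:R^-1 *: A ^+ k) S]_k].

Section Fourier.
Variable n : nat.
(* gen (lshift n i) is e_i and gen (rshift n i) is e'_i. *)
Local Notation G2n := (clifford R (n + n)).
Implicit Types (f : rspace n -> G2n) (x y : rspace n).

Definition bivec (i : 'I_n) : G2n := gen R (lshift n i) * gen R (rshift n i).

Lemma bivec_sq i : bivec i * bivec i = -1.
Proof.
rewrite /bivec mulrA -(mulrA (gen _ _)) (gen_anti _ (i := rshift n i)).
  by rewrite mulrN mulNr mulrA genK mul1r genK.
by rewrite eq_rlshift.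
Qed.

Lemma bivecC i j : bivec i * bivec j = bivec j * bivec i.
Proof.
have [->//|ij] := eqVneq i j.
have comm k : k != lshift n j -> k != rshift n j ->
    gen R k * bivec j = bivec j * gen R k.
  move=> kl kr; rewrite /bivec mulrA (gen_anti _ kl) mulNr -(mulrA _ (gen R k)).
  by rewrite (gen_anti _ kr) mulrN opprK mulrA.
rewrite {1}/bivec -mulrA comm ?eq_rlshift ?eq_rshift //.
by rewrite mulrA comm ?eq_lrshift ?eq_lshift // mulrA.
Qed.

Definition biform x y : G2n := \sum_(i < n) (tnth x i * tnth y i) *: bivec i.

Definition L1 f : Prop :=
  (forall S, lebesgue_measurable (fun x => ccoef (f x) S)) /\
  (\int[fmeas n]_x (cnorm (f x))%:E < +oo)%E.

Definition cintegral f : G2n := [ffun S => \int[fmeas n]_x ccoef (f x) S].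

Definition fourierL f : rspace n -> G2n :=
  fun y => cintegral (fun x => cexp (- biform x y) * f x).

Definition fourierR f : rspace n -> G2n :=
  fun y => cintegral (fun x => f x * cexp (- biform x y)).

Definition ropp x : rspace n := [tuple - tnth x i | i < n].

End Fourier.

End FourierSetting.

(* Main.v *)
Require Import Defs.
From mathcomp Require Import all_boot all_order all_algebra.
From mathcomp Require Import all_classical all_reals all_analysis.
From mathcomp Require Import measurable_realfun ring lra.

(** The inversion formula is obtained by Abel summation.

    The bivectors [bivec i] commute and have square [-1], so the exponential of
    [- biform x y] is the product of the rotations [cos (x_i y_i) - sin (x_i y_i)
    bivec i] ([cexp_torus]).  Consequently it is a character in [x], and its
    coordinates are products of sines and cosines.

    To compute the square of the transform at [- x], insert the weight
    [prod_i exp (- eps |y_i|)] in the outer integral.  By Fubini's theorem and the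
    character property, the weighted integral is an integral of [f z] against a
    kernel depending on [x - z], namely the integral over [y] of the weight times
    the character.  The terms of the character that contain a sine integrate to
    [0] by parity, and the product of the cosines gives the product of the Poisson
    kernels [eps / (pi (eps ^ 2 + (x_i - z_i) ^ 2))] ([kernel_laplace],
    [laplace_sfourier]).  If the transform of [f] is integrable, dominated
    convergence shows that, at every point [x], the square of the transform at
    [- x] is the limit of the Poisson smoothings of [f] at [x] when [eps] tends to
    [0] ([smooth_cvg_sfourier2]).  As the Poisson kernel is a scalar, these
    smoothings do not depend on the side on which the exponentials act; hence the
    two squares are equal everywhere.

    It remains to recover [f] almost everywhere from the pointwise limit [h] of its
    smoothings ([smooth_limit_ae]).  Integrate the smoothings over a box: on the
    one hand the integrals tend to that of [h], since the smoothings are uniformly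
    bounded in terms of the norm of the integrable transform; on the other hand, by
    Fubini's theorem, they are integrals of [f] against products of differences of
    arctangents, which are bounded by [1] and tend to the indicator of the box off
    its faces ([cvg_box_smooth]).  So [f] and [h] have the same integral over every
    box, and they coincide almost everywhere by the pi-lambda theorem
    ([ae0_of_boxes]).

    The function [f] is only Lebesgue measurable; it is first replaced by a Borel
    function equal to it off a null set ([L1_borel]). *)

Set Implicit Arguments.
Unset Strict Implicit.
Unset Printing Implicit Defensive.
Import Order.TTheory GRing.Theory Num.Theory.
Import numFieldNormedType.Exports.
Local Open Scope classical_set_scope.
Local Open Scope ring_scope.

(** * Exponentials of commuting square roots of -1 *)

Section PlaneRotations.
Variables (R : realType) (A : algType R).
Implicit Types (a b c : R) (B J P : A).

Definition rot B a : A := cos a *: 1 + sin a *: B.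

Lemma rot0 B : rot B 0 = 1.
Proof. by rewrite /rot cos0 sin0 scale0r scale1r addr0. Qed.

(** The addition formulas for sine and cosine. *)
Lemma rotM B a b : B * B = -1 -> rot B a * rot B b = rot B (a + b).
Proof.
move=> B2; rewrite /rot mulrDl !mulrDr -!scalerAl -!scalerAr !mul1r mulr1 B2.
rewrite !scalerA cosD sinD scalerN !scalerDl scaleNr addrACA -addrA.
rewrite [in X in _ + X]addrC -!addrA; congr (_ + _).
by rewrite addrC -!addrA; congr (_ + _); rewrite addrC.
Qed.

Lemma rot_commr B x a : GRing.comm x B -> GRing.comm x (rot B a).
Proof.
move=> xB; rewrite /GRing.comm /rot mulrDl mulrDr -!scalerAl -!scalerAr.
by rewrite mulr1 mul1r xB.
Qed.

Lemma rot_comm B B' a b :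
  GRing.comm B B' -> GRing.comm (rot B a) (rot B' b).
Proof. by move=> /(rot_commr b) /commr_sym /(rot_commr a) /commr_sym. Qed.

Section Torus.
Variables (n : nat) (B : 'I_n -> A).
Hypothesis B2 : forall i, B i * B i = -1.
Hypothesis BC : forall i j, GRing.comm (B i) (B j).

Definition torus (a : 'I_n -> R) : A := \prod_i rot (B i) (a i).

Lemma torusM (a b : 'I_n -> R) : torus a * torus b = torus (fun i => a i + b i).
Proof.
rewrite /torus -prodrM_comm; last by move=> i j _ _; exact: rot_comm.
by apply: eq_bigr => i _; rewrite rotM.
Qed.

Definition trig (s : {ffun 'I_n -> bool}) (a : 'I_n -> R) : R :=
  \prod_i (if s i then sin (a i) else cos (a i)).

Definition Bprod (s : {ffun 'I_n -> bool}) : A :=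
  \prod_i (if s i then B i else 1).

(** Distributing the product makes the coordinates of [torus B a] products of
    sines and cosines: this is the form in which the Fourier kernel is bounded
    and integrated. *)
Lemma torusE (a : 'I_n -> R) : torus a = \sum_s trig s a *: Bprod s.
Proof.
transitivity (\prod_i \sum_(j : bool)
    (if j then sin (a i) else cos (a i)) *: (if j then B i else 1)).
  by apply: eq_bigr => i _; rewrite big_bool /= addrC.
by rewrite bigA_distr_bigA; apply: eq_bigr => s _; rewrite scaler_prod.
Qed.

End Torus.

(** The pairs of [s] consist of a real eigenvalue and the element of a
    decomposition of [1] on which [X] acts as that multiple of [J].  Replacing
    [X] by its exponential turns each multiple of [J] into a rotation, so [Y] is
    what the exponential of [X] has to be. *)
Definition diagonalizes J X (Y : A) (s : seq (R * A)) :=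
  [/\ \sum_(p <- s) p.2 = 1,
      forall p, p \in s -> X * p.2 = p.1 *: (J * p.2) &
      \sum_(p <- s) rot J p.1 * p.2 = Y].

(** As [J] and [B] are commuting square roots of [-1], the idempotents
    [(1 - J * B) / 2] and [(1 + J * B) / 2] have sum [1], and [B] acts on them as
    [J] and as [- J].  Multiplying the old decomposition by them shifts the
    eigenvalues by [b] and by [- b]. *)
Lemma diagonalizesD J B X Y s b :
  J * J = -1 -> B * B = -1 -> GRing.comm J B -> GRing.comm X J ->
  GRing.comm X B -> diagonalizes J X Y s ->
  exists s', diagonalizes J (X + b *: B) (rot B b * Y) s'.
Proof.
move=> J2 B2 JB XJ XB [s1 sX sY].
(* Only e = 1 and e = -1 are used; B acts on Q e as - e times J. *)
pose Q e : A := 2^-1 *: (1 + e *: (J * B)).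
have BQ e : e * e = 1 -> B * Q e = - e *: (J * Q e).
  move=> e2; rewrite /Q -!scalerAr scalerA mulrC -scalerA; congr (_ *: _).
  rewrite !mulrDr !mulr1 -!scalerAr scalerDr scalerA mulrA -JB -mulrA B2 mulrN1.
  by rewrite mulrA J2 mulN1r mulNr e2 scaleN1r scaleNr scalerN opprK addrC.
have XQ e : X * Q e = Q e * X.
  rewrite /Q -scalerAr -scalerAl mulrDr mulrDl mulr1 mul1r -scalerAr -scalerAl.
  by rewrite mulrA XJ -mulrA XB mulrA.
have JQ e : J * Q e = Q e * J.
  rewrite /Q -scalerAr -scalerAl mulrDr mulrDl mulr1 mul1r -scalerAr -scalerAl.
  by rewrite -(mulrA J B) -JB.
have Q1 : Q (-1) + Q 1 = 1.
  rewrite /Q -scalerDr scaleN1r scale1r addrACA addNr addr0 scalerDr -scalerDl.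
  rewrite (_ : 2^-1 + 2^-1 = 1 :> R) ?scale1r //; lra.
have JbJ e : e * e = 1 -> rot J (e * b) * Q (- e) = rot B b * Q (- e).
  move=> e2; rewrite /rot mulrDl [RHS]mulrDl -!scalerAl BQ ?mulrNN // opprK.
  case: (eqVneq e 1) => [->|ne1]; first by rewrite scale1r !mul1r.
  have -> : e = -1.
    by apply/eqP; move/eqP: e2; rewrite -expr2 sqrf_eq1 (negPf ne1).
  by rewrite !mulN1r cosN sinN scaleNr scaleN1r scalerN.
clearbody Q.
pose s' := [seq (p.1 + b, Q (-1) * p.2) | p <- s] ++
           [seq (p.1 - b, Q 1 * p.2) | p <- s].
exists s'; split.
- rewrite big_cat /= !big_map /= -big_split -[RHS]s1 /=; apply: eq_bigr => p _ /=.
  by rewrite -mulrDl Q1 mul1r.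
- have act e (q : R * A) : q \in s -> e * e = 1 ->
      (X + b *: B) * (Q e * q.2) = (q.1 - e * b) *: (J * (Q e * q.2)).
    move=> /sX qX e2; rewrite mulrDl (mulrA X) XQ -(mulrA (Q e) X) qX.
    rewrite -(scalerAr _ (Q e)) -(scalerAl _ B) (mulrA B) (BQ _ e2) -scalerAl.
    rewrite scalerA (mulrA (Q e)) -JQ -(mulrA J (Q e)) -scalerDl.
    by rewrite mulrN (mulrC b).
  move=> p; rewrite mem_cat => /orP[] /mapP[q qs ->] /=.
    by rewrite act ?mulrNN ?mulr1 // mulN1r opprK.
  by rewrite act ?mulr1 // mul1r.
- rewrite big_cat /= !big_map /= -big_split -sY mulr_sumr; apply: eq_bigr => p _ /=.
  rewrite -!rotM // -!mulrA.
  have JQC e c : rot J c * (Q e * p.2) = Q e * (rot J c * p.2).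
    rewrite !mulrA; congr (_ * _); rewrite /rot mulrDl mulrDr -!scalerAl.
    by rewrite -!scalerAr mul1r mulr1 JQ.
  have rC c d : GRing.comm (rot J c) (rot J d) by apply: rot_comm.
  have -> : rot J p.1 * (rot J b * (Q (-1) * p.2)) =
      rot B b * (Q (-1) * (rot J p.1 * p.2)).
    by rewrite mulrA rC -mulrA JQC !mulrA -(mul1r b) JbJ ?mul1r.
  have -> : rot J p.1 * (rot J (- b) * (Q 1 * p.2)) =
      rot B b * (Q 1 * (rot J p.1 * p.2)).
    rewrite mulrA rC -mulrA JQC !mulrA -mulN1r.
    by have := JbJ (-1); rewrite opprK => ->; rewrite ?mulrNN ?mulr1.
  by rewrite -mulrDr -mulrDl Q1 mul1r.
Qed.

Lemma torus_diagonalizes n (B : 'I_n -> A) (a : 'I_n -> R) J :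
  J * J = -1 -> (forall i, B i * B i = -1) -> (forall i, GRing.comm J (B i)) ->
  (forall i j, GRing.comm (B i) (B j)) ->
  exists s, diagonalizes J (\sum_i a i *: B i) (torus B a) s.
Proof.
move=> J2 B2 JB BC.
have cS (r : seq 'I_n) y : (forall i, GRing.comm (B i) y) ->
    GRing.comm (\sum_(i <- r) a i *: B i) y.
  move=> By; rewrite /GRing.comm mulr_suml mulr_sumr.
  by apply: eq_bigr => i _; rewrite -scalerAl -scalerAr By.
rewrite /torus; elim: (index_enum _) => [|i r [s ih]].
  exists [:: (0, 1)]; rewrite !big_nil; split.
  - by rewrite big_seq1.
  - by move=> p; rewrite inE => /eqP -> /=; rewrite mul0r scale0r.
  - by rewrite big_seq1 rot0 mulr1.
rewrite !big_cons addrC; apply: (diagonalizesD _ _ _ _ _ _ ih) => //.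
  by apply: cS => j; apply/commr_sym.
exact: cS.
Qed.

(** The even powers of [J] are [1] or [-1] and the odd ones are [J] or [- J], so
    the terms of the exponential series split into those of cosine and sine. *)
Lemma diagonalizesX J X Y s k : J * J = -1 -> GRing.comm X J ->
  diagonalizes J X Y s ->
  (k`!%:R^-1 : R) *: X ^+ k =
  \sum_(p <- s) (cos_coeff p.1 k *: p.2 + sin_coeff p.1 k *: (J * p.2)).
Proof.
move=> J2 XJ [s1 sX _]; rewrite -[X ^+ k]mulr1 -s1 mulr_sumr scaler_sumr.
rewrite big_seq [RHS]big_seq; apply: eq_bigr => p /sX {}sX.
have -> : X ^+ k * p.2 = p.1 ^+ k *: (J ^+ k * p.2).
  elim: k => [|k ih]; first by rewrite !expr0 scale1r.
  rewrite exprS -mulrA ih -scalerAr mulrA.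
  rewrite (commrX k XJ) -mulrA sX -scalerAr scalerA.
  by rewrite mulrA -exprSr -exprSr.
have JX : J ^+ k = ((~~ odd k)%:R * (-1) ^+ k./2) *: 1 +
                   ((odd k)%:R * (-1) ^+ k.-1./2) *: J.
  have Je j : J ^+ (j.*2) = (-1) ^+ j *: 1.
    elim: j => [|j ih]; first by rewrite !expr0 scale1r.
    by rewrite doubleS 2!exprS mulrA J2 mulN1r ih exprS mulN1r scaleNr.
  rewrite -[in LHS](odd_double_half k); case: (boolP (odd k)) => ok /=.
    rewrite exprS Je mul0r scale0r add0r mul1r -scalerAr mulr1.
    by rewrite -{2}(odd_double_half k) ok /= doubleK.
  by rewrite add0n Je mul1r mul0r scale0r addr0.
rewrite JX mulrDl -!scalerAl mul1r !scalerDr !scalerA /cos_coeff /sin_coeff /=.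
rewrite -exprnP; move: (_ ^+ k./2) (_ ^+ k.-1./2) (_`!%:R^-1) => u v w.
by congr (_ *: _ + _ *: _); ring.
Qed.

End PlaneRotations.

Section Exponential.
Variable R : realType.

Lemma cexp_diag m (J X Y : clifford R m) s : J * J = -1 -> GRing.comm X J ->
  diagonalizes J X Y s -> cexp X = Y.
Proof.
move=> J2 XJ dX; apply/cliffP => S; rewrite ccoefE; apply/cvg_lim => //.
have cS (I : Type) (r : seq I) (F : I -> clifford R m) :
    ccoef (\sum_(i <- r) F i) S = \sum_(i <- r) ccoef (F i) S.
  elim: r => [|i r ih]; first by rewrite !big_nil /ccoef ffunE.
  by rewrite !big_cons ccoefD ih.
have -> : [series ccoef (k`!%:R^-1 *: X ^+ k) S]_k = (fun N =>
    \sum_(p <- s) (series (cos_coeff p.1) N * ccoef p.2 S +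
                   series (sin_coeff p.1) N * ccoef (J * p.2) S)).
  apply/funext => N; rewrite /series /=.
  under eq_bigr do rewrite (diagonalizesX _ J2 XJ dX) cS.
  rewrite exchange_big /=; apply: eq_bigr => p _.
  rewrite !mulr_suml -big_split; apply: eq_bigr => k _ /=.
  by rewrite ccoefD !ccoefZ.
have -> : ccoef Y S = \sum_(p <- s) (cos p.1 * ccoef p.2 S +
                                     sin p.1 * ccoef (J * p.2) S).
  case: dX => _ _ <-; rewrite cS; apply: eq_bigr => p _.
  by rewrite /rot mulrDl -!scalerAl mul1r ccoefD !ccoefZ.
apply: cvg_big => [|p _]; first exact: add_continuous.
apply: cvgD; apply: cvgMl.
- by rewrite unlock; exact: is_cvg_series_cos_coeff.
- by rewrite unlock; exact: is_cvg_series_sin_coeff.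
Qed.

(** If there is at least one [B i], the first one serves as the common square
    root [J] of [-1] in the diagonalization. *)
Lemma cexp_torus n m (B : 'I_n -> clifford R m) (a : 'I_n -> R) :
  (forall i, B i * B i = -1) -> (forall i j, GRing.comm (B i) (B j)) ->
  cexp (\sum_i a i *: B i) = torus B a.
Proof.
case: n B a => [|n] B a B2 BC; last first.
  have [s ds] := torus_diagonalizes a (B2 ord0) B2 (BC ord0) BC.
  apply: (cexp_diag (B2 ord0) _ ds).
  rewrite /GRing.comm mulr_suml mulr_sumr.
  by apply: eq_bigr => i _; rewrite -scalerAl -scalerAr BC.
rewrite /torus !big_ord0; apply/cliffP => S; rewrite ccoefE.
apply/cvg_lim => //; rewrite -cvg_shiftS; apply: cvg_near_cst; apply: nearW => N.
rewrite /series /= big_nat_recl // big1 ?addr0 ?fact0 ?invr1 ?scale1r //.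
by move=> k _; rewrite exprS mul0r scaler0 /ccoef ffunE.
Qed.

End Exponential.

(** * Null sets and completion *)

Section NullSets.
Local Open Scope ereal_scope.
Import HBSimple HBNNSimple.
Context d (T : measurableType d) (R : realType).
Variables (mu : {measure set T -> \bar R}) (N : set T).
Hypotheses (mN : measurable N) (N0 : mu N = 0).

(** The integral of a nonnegative function, measurable or not, is a supremum over
    the simple functions below it, and making those vanish on [N] does not change
    their integrals. *)
Lemma ge0_le_integral_off_null (f g : T -> \bar R) :
  (forall x, 0 <= f x) -> (forall x, 0 <= g x) ->
  (forall x, ~ N x -> f x <= g x) -> \int[mu]_x f x <= \int[mu]_x g x.
Proof.
move=> f0 g0 fg; rewrite !ge0_integralTE //; apply: ge_ereal_sup => _ [h hf <-].
apply: ereal_sup_ubound.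
have mCN : measurable (~` N) by exact: measurableC.
exists (proj_nnsfun h mCN) => [x /=|].
  rewrite /= /mindic indicE; have [xN|xN] := boolP (x \in ~` N).
    by rewrite mulr1 (le_trans (hf x)) // fg //; apply: set_mem xN.
  by rewrite mulr0.
rewrite -!integralT_nnsfun [RHS](ge0_negligible_integral mN) //=; last first.
- by move=> x _; rewrite lee_fin.
- exact/measurable_EFinP.
rewrite setTD [RHS]integral_mkcond; apply: eq_integral => x _.
by rewrite /= /mindic indicE /patch; case: ifP => _; rewrite ?mulr1 ?mulr0.
Qed.

Lemma integral_off_null (f g : T -> \bar R) :
  (forall x, ~ N x -> f x = g x) -> \int[mu]_x f x = \int[mu]_x g x.
Proof.
move=> fg; rewrite integralE [RHS]integralE.
by congr (_ - _); apply/eqP; rewrite eq_le; apply/andP; split;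
  apply: ge0_le_integral_off_null => // x Nx;
  by rewrite !unlock fg.
Qed.

End NullSets.

Lemma fin_bigcup_null d (T : measurableType d) (R : realType)
    (mu : {measure set T -> \bar R}) (I : finType) (N : I -> set T) :
  (forall i, measurable (N i)) -> (forall i, mu (N i) = 0%E) ->
  measurable [set x | exists i, N i x] /\ mu [set x | exists i, N i x] = 0%E.
Proof.
move=> mN N0; have -> : [set x | exists i, N i x] = \big[setU/set0]_i N i.
  rewrite -bigcup_seq; apply/seteqP; split=> x /=.
    by move=> [i xi]; exists i => //=; rewrite mem_index_enum.
  by move=> [i _ xi]; exists i.
apply: (big_ind (fun A : set T => measurable A /\ mu A = 0%E)) => [|A B|i _].
- by split => //; exact: measure0.
- by move=> [mA A0] [mB B0]; split; [exact: measurableU|exact: null_set_setU].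
- by split.
Qed.

Section Completion.
Context d (T : measurableType d) (R : realType).
Variables (mu : {measure set T -> \bar R}) (g : T -> R).

(** For each rational [r] the set [g < r] is Borel up to a null set; removing the
    countably many exceptional sets makes [g] Borel. *)
Lemma completed_measurableP :
  (forall B : set (measurableTypeR R), measurable B ->
     completed_algebra_gen mu (g @^-1` B)) ->
  exists g' : T -> R, measurable_fun setT g' /\
    exists N, [/\ measurable N, mu N = 0%E & forall x, ~ N x -> g x = g' x].
Proof.
move=> gm; (* The rationals, with 0 at the indices that code no rational. *)
pose r k : R := ratr (odflt 0 (unpickle k)).
have rayP k : exists AM : set T * set T, [/\ measurable AM.1, measurable AM.2,
    mu AM.2 = 0%E & forall x, ~ AM.2 x -> (AM.1 x <-> g x < r k)].
  have mray : measurable (`]-oo, r k[%classic : set (measurableTypeR R)).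
    exact: measurable_itv.
  have [A mA [N0 [M [mM M0 N0M]] E]] := gm _ mray.
  exists (A, M); split=> // x Mx.
  have -> : (g x < r k) = (g @^-1` `]-oo, r k[%classic) x :> Prop.
    by rewrite /= in_itv.
  by rewrite -E; split; [left|case=> // /N0M].
have [AM AMP] := choice rayP.
pose N := \bigcup_k (AM k).2.
have mN : measurable N by apply: bigcupT_measurable => k; case: (AMP k).
have N0 : mu N = 0%E.
  apply/(negligibleP _ mN); apply: negligible_bigcup => k.
  by have [_ m2 z _] := AMP k; apply/negligibleP.
exists (g \_ (~` N)); split; last first.
  by exists N; split => // x Nx; rewrite patchE mem_set.
apply/(measurable_restrict _ (measurableC mN) measurableT); rewrite setTI.
apply: (measurability _ (RGenInftyO.measurableE R)) => _ [_ [x ->] <-].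
have -> : ~` N `&` g @^-1` `]-oo, x[%classic =
    ~` N `&` \bigcup_k (if r k < x then (AM k).1 else set0).
  apply/seteqP; split=> y [Ny yx]; split=> //.
    move: yx; rewrite /= in_itv /= => /rat_in_itvoo[q].
    rewrite in_itv /= => /andP[yq qx].
    have rq : r (pickle q) = ratr q by rewrite /r pickleK.
    exists (pickle q) => //; rewrite rq qx.
    have [_ _ _ /(_ y) ->] := AMP (pickle q); first by rewrite rq.
    by apply: contra_not Ny => My; exists (pickle q).
  move: yx => [k _]; case: ifP => // kx Ak.
  rewrite /= in_itv /=; apply: lt_trans kx.
  have [_ _ _ /(_ y) <-//] := AMP k.
  by apply: contra_not Ny => My; exists k.
apply: measurableI; first exact: measurableC.
by apply: bigcupT_measurable => k; case: ifP => // _; case: (AMP k).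
Qed.

End Completion.

(** * Integrals of real-valued functions *)

Notation integrableR mu f := (mu.-integrable setT (EFin \o f)).

Section RealIntegral.
Context d (T : measurableType d) (R : realType).
Variable mu : {measure set T -> \bar R}.
Implicit Types f g u : T -> R.

Lemma integrableR_measurable f : integrableR mu f -> measurable_fun setT f.
Proof. by move=> /integrableP[/measurable_EFinP]. Qed.

Lemma integrableR_le f u : measurable_fun setT f -> (forall x, `|f x| <= u x) ->
  integrableR mu u -> integrableR mu f.
Proof.
move=> mf fu; apply: le_integrable => // [|x _ /=]; first exact/measurable_EFinP.
by rewrite lee_fin (le_trans (fu x)) // ler_norm.
Qed.

Lemma integrableRZ f c : integrableR mu f -> integrableR mu (fun x => c * f x).
Proof. exact: (integrableZl measurableT c). Qed.

Lemma integrableRM_bounded f g c : integrableR mu f -> measurable_fun setT g ->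
  (forall x, `|g x| <= c) -> integrableR mu (fun x => g x * f x).
Proof.
move=> intf mg gc; have mf := integrableR_measurable intf.
apply: (@integrableR_le _ (fun x => c * `|f x|)).
- exact: measurable_funM.
- by move=> x; rewrite normrM ler_wpM2r.
- by apply: integrableRZ; exact: integrable_norm.
Qed.

Lemma EFin_Rintegral f : integrableR mu f ->
  (\int[mu]_x f x)%:E = (\int[mu]_x (f x)%:E)%E.
Proof. by move=> intf; rewrite /Rintegral fineK //; exact: integrable_fin_num. Qed.

Lemma integrableR_sum (I : Type) (s : seq I) (F : I -> T -> R) :
  (forall i, integrableR mu (F i)) ->
  integrableR mu (fun x => \sum_(i <- s) F i x).
Proof.
move=> iF; rewrite (_ : _ \o _ = fun x => (\sum_(i <- s) (F i x)%:E)%E).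
  apply: (@integrable_sum _ _ _ mu setT measurableT I s xpredT
    (fun i x => (F i x)%:E)) => i _; exact: iF.
by apply/funext => x /=; rewrite sumEFin.
Qed.

Lemma Rintegral_sum (I : Type) (s : seq I) (F : I -> T -> R) :
  (forall i, integrableR mu (F i)) ->
  \int[mu]_x (\sum_(i <- s) F i x) = \sum_(i <- s) \int[mu]_x F i x.
Proof.
move=> iF; apply/EFin_inj; rewrite EFin_Rintegral; last exact: integrableR_sum.
under eq_integral do rewrite -sumEFin.
rewrite integral_sum // -sumEFin; apply: eq_bigr => i _.
by rewrite EFin_Rintegral.
Qed.

Lemma le_norm_Rintegral f u : integrableR mu f -> integrableR mu u ->
  (forall x, `|f x| <= u x) -> `|\int[mu]_x f x| <= \int[mu]_x u x.
Proof.
move=> intf intu fu; apply: le_trans (le_normr_Rintegral _ intf) _ => //.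
by apply: le_Rintegral => //; exact: integrable_norm.
Qed.

Lemma Rintegral_dominated_cvg (F : nat -> T -> R) f u :
  (forall k, measurable_fun setT (F k)) -> measurable_fun setT f ->
  (forall x, F ^~ x @ \oo --> f x) -> integrableR mu u ->
  (forall k x, `|F k x| <= u x) ->
  (fun k => \int[mu]_x F k x) @ \oo --> \int[mu]_x f x.
Proof.
move=> mF mf Ff intu Fu.
have iF k : integrableR mu (F k) by exact: integrableR_le intu.
have [//|||||intf _] := @dominated_convergence _ _ _ mu _ measurableT
  (fun k => EFin \o F k) (EFin \o f) (EFin \o u).
- by move=> k; exact/measurable_EFinP.
- exact/measurable_EFinP.
- by apply: aeW => x _; apply: cvg_EFin; [exact: nearW|exact: Ff].
- exact: intu.
- by apply: aeW => x k _; rewrite /= lee_fin.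
rewrite /= -(EFin_Rintegral intf) => /fine_cvg; apply: cvg_trans.
by apply: near_eq_cvg; apply: nearW => k /=; rewrite -EFin_Rintegral.
Qed.

End RealIntegral.

(** In this section a product of integrable functions dominates [F], so every
    slice of [F] is integrable and no exceptional set appears in Fubini's theorem
    for real-valued integrals. *)
Section RealFubini.
Context d1 d2 (T1 : measurableType d1) (T2 : measurableType d2) (R : realType).
Variable m1 : {sigma_finite_measure set T1 -> \bar R}.
Variable m2 : {sigma_finite_measure set T2 -> \bar R}.
Variables (F : T1 -> T2 -> R) (u : T1 -> R) (v : T2 -> R).
Hypothesis mF : measurable_fun setT (fun p : T1 * T2 => F p.1 p.2).
Hypothesis Fuv : forall x y, `|F x y| <= u x * v y.
Hypotheses (iu : integrableR m1 u) (iv : integrableR m2 v).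

Lemma measurable_slice1 x : measurable_fun setT (F x).
Proof. exact: (measurableT_comp mF (pair1_measurable x)). Qed.

Lemma measurable_slice2 y : measurable_fun setT (F^~ y).
Proof. exact: (measurableT_comp mF (pair2_measurable y)). Qed.

Lemma integrableR_prod :
  integrableR (m1 \x m2)%E (fun p : T1 * T2 => F p.1 p.2).
Proof.
apply/integrable12ltyP => /=; first exact/measurable_EFinP.
have mu' := integrableR_measurable iu; have mv' := integrableR_measurable iv.
have ivn := integrable_norm iv.
have iun := integrable_norm iu.
pose V : R := \int[m2]_y `|v y|.
have E x : (\int[m2]_y (`|u x| * `|v y|)%R%:E)%E = (V * `|u x|)%:E.
  rewrite /V mulrC -RintegralZl // EFin_Rintegral //.
  exact: integrableRZ.
apply: (@le_lt_trans _ _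
    (\int[m1]_x \int[m2]_y (`|u x| * `|v y|)%R%:E)%E); last first.
  under eq_integral do rewrite E.
  by rewrite -EFin_Rintegral ?ltry //; exact: integrableRZ.
apply: ge0_le_integral => //.
- by move=> x _; exact: integral_ge0.
- apply: (@measurable_fun_fubini_tonelli_F _ _ _ _ _ m2
    (fun p => `|(F p.1 p.2)%:E|%E)) => //.
  by apply/measurableT_comp => //; exact/measurable_EFinP.
- rewrite (_ : (fun _ => _) = fun x => (V * `|u x|)%:E).
    by apply/measurable_EFinP/measurable_funM => //; exact: measurableT_comp.
  by apply/funext => x; rewrite E.
move=> x _; apply: ge0_le_integral => //.
- apply/measurable_EFinP/measurableT_comp => //.
  exact: measurable_slice1.
- by apply/measurable_EFinP/measurable_funM => //; exact: measurableT_comp.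
- by move=> y _; rewrite /= lee_fin -normrM (le_trans (Fuv x y)) // ler_norm.
Qed.

Lemma integrableR_slice1 x : integrableR m2 (F x).
Proof.
apply: (@integrableR_le _ _ _ _ _ (fun y => u x * v y)) => //.
  exact: measurable_slice1.
exact: integrableRZ.
Qed.

Lemma integrableR_slice2 y : integrableR m1 (F^~ y).
Proof.
apply: (@integrableR_le _ _ _ _ _ (fun x => v y * u x)) => //.
- exact: measurable_slice2.
- by move=> x; rewrite mulrC.
- exact: integrableRZ.
Qed.

Lemma EFin_fubini_F x :
  fubini_F m2 (fun p => (F p.1 p.2)%:E) x = (\int[m2]_y F x y)%:E.
Proof. by rewrite EFin_Rintegral //; exact: integrableR_slice1. Qed.

Lemma Rintegral_prod12 :
  \int[m1]_x \int[m2]_y F x y = \int[(m1 \x m2)%E]_p F p.1 p.2.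
Proof.
rewrite /Rintegral; congr fine; rewrite -(integral12_prod_meas1 integrableR_prod).
by apply: eq_integral => x _; rewrite -EFin_fubini_F.
Qed.

Lemma integrable_Rintegral : integrableR m1 (fun x => \int[m2]_y F x y).
Proof.
have := integrable_fubini_F integrableR_prod; congr (_.-integrable _ _).
by apply/funext => x; rewrite EFin_fubini_F.
Qed.

Lemma Rintegral_swap :
  \int[m1]_x \int[m2]_y F x y = \int[m2]_y \int[m1]_x F x y.
Proof.
rewrite Rintegral_prod12 /Rintegral; congr fine.
rewrite -(integral21_prod_meas1 integrableR_prod).
by apply: eq_integral => y _; rewrite EFin_Rintegral //; exact: integrableR_slice2.
Qed.

End RealFubini.

(** * Integration on R^n *)

Section Mscale.
Context d (T : measurableType d) (R : realType).
Variables (m : {measure set T -> \bar R}) (k : {nonneg R}).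
Hypothesis k0 : 0 < k%:num.

Lemma integrableR_mscale (f : T -> R) :
  integrableR (mscale k m) f <-> integrableR m f.
Proof.
split=> /integrableP[mf oo]; apply/integrableP; split => //; move: oo;
  rewrite ge0_integral_mscale //; do ?exact: measurableT_comp;
  have : (0 <= \int[m]_x `|(EFin \o f) x|)%E by exact: integral_ge0.
  case: (\int[m]_x _)%E => [r _ _||//]; first by rewrite ltry.
  by move=> _; rewrite gt0_muley ?lte_fin.
by case: (\int[m]_x _)%E => [r _ _||//]; rewrite ?ltxx // -EFinM ltry.
Qed.

Lemma Rintegral_mscale (f : T -> R) : integrableR m f ->
  \int[mscale k m]_x f x = k%:num * \int[m]_x f x.
Proof.
move=> intf; have intf' := (integrableR_mscale f).2 intf.
apply: EFin_inj; rewrite EFinM !EFin_Rintegral //.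
have /integrableP[mf _] := intf.
have fp := integrable_pos_fin_num measurableT intf.
have fn := integrable_neg_fin_num measurableT intf.
rewrite integralE [in RHS]integralE muleBr ?fin_num_adde_defl //; last first.
  by rewrite fin_numN.
rewrite !ge0_integral_mscale //.
- exact: measurable_funeneg.
- exact: measurable_funepos.
Qed.

End Mscale.

Section LebesgueRn.
Variable R : realType.
Local Notation L := (lebesgue R).

Lemma integrable_lebesgueS n (f : rspace R n.+1 -> R) :
  measurable_fun setT f ->
  integrableR (@lebesgue_measure R \x L n)%E (f \o @tcons R n) ->
  integrableR (L n.+1) f /\
  \int[L n.+1]_x f x =
  \int[(@lebesgue_measure R \x L n)%E]_p f (tcons p).
Proof.
move=> mf intf; split.
  apply: (@integrable_pushforward _ _ _ _ _ _ (@measurable_tcons R n)) => //.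
  exact/measurable_EFinP.
rewrite /Rintegral; congr fine.
apply: (@integral_pushforward _ _ _ _ _ _ (@measurable_tcons R n)) => //.
exact/measurable_EFinP.
Qed.

Lemma measurable_prod_tnth n (g : 'I_n -> measurableTypeR R -> R) :
  (forall i, measurable_fun setT (g i)) ->
  measurable_fun setT (fun x : rspace R n => \prod_i g i (tnth x i)).
Proof.
move=> mg; apply: measurable_prod => i _.
exact: (measurableT_comp (mg i) (measurable_tnth i)).
Qed.

(** Integrating a product of functions of one coordinate each: induction on the
    dimension, splitting off the first coordinate. *)
Lemma lebesgue_integral_prod n (g : 'I_n -> measurableTypeR R -> R) :
  (forall i, integrableR (@lebesgue_measure R) (g i)) ->
  integrableR (L n) (fun x => \prod_i g i (tnth x i)) /\
  \int[L n]_x (\prod_i g i (tnth x i)) =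
    \prod_i \int[@lebesgue_measure R]_t g i t.
Proof.
move=> ig; have mg i := integrableR_measurable (ig i).
have := measurable_prod_tnth mg.
elim: n g ig mg => [|n ih] g ig mg mprod.
  split.
    apply/integrableP; split; first exact/measurable_EFinP.
    rewrite /= integral_dirac //; last by apply/measurable_EFinP/measurableT_comp.
    by rewrite diracT mul1e ltry.
  rewrite big_ord0 /Rintegral /= integral_dirac //; last exact/measurable_EFinP.
  by rewrite diracT mul1e /= big_ord0.
pose g' i := g (lift ord0 i).
have [ig' Eg'] := ih g' (fun i => ig _) (fun i => mg _)
  (measurable_prod_tnth (fun i => mg _)).
pose F (t : measurableTypeR R) (y : rspace R n) :=
  g ord0 t * \prod_i g' i (tnth y i).
have FE p : \prod_i g i (tnth (tcons p) i) = F p.1 p.2.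
  rewrite /F big_ord_recl /=; congr (_ * _); apply: eq_bigr => i _.
  by rewrite tnthS.
have mF : measurable_fun setT (fun p => F p.1 p.2).
  rewrite (_ : (fun _ => _) =
      (fun x : rspace R n.+1 => \prod_i g i (tnth x i)) \o @tcons R n).
    exact: measurableT_comp mprod (@measurable_tcons R n).
  by apply/funext => p /=; rewrite FE.
have Fle x y : `|F x y| <= `|g ord0 x| * `|\prod_i g' i (tnth y i)|.
  by rewrite normrM.
have i1 := integrable_norm (ig ord0).
have i2 := integrable_norm ig'.
have [|iP ->] := integrable_lebesgueS mprod.
  rewrite (_ : _ \o _ = fun p => F p.1 p.2).
    exact: (integrableR_prod mF Fle).
  by apply/funext => p /=; rewrite FE.
split=> //; under eq_Rintegral do rewrite FE.
rewrite -(Rintegral_prod12 mF Fle i1 i2) big_ord_recl -Eg' -RintegralZr //.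
by apply: eq_Rintegral => t _; rewrite /F RintegralZl.
Qed.

Lemma lebesgue_hyperplane n (i : 'I_n) (a : R) :
  L n [set x | tnth x i = a] = 0%E.
Proof.
pose A (j : 'I_n) : set (measurableTypeR R) := if j == i then [set a] else setT.
have -> : [set x | tnth x i = a] =
    [set x : rspace R n | forall j, A j (tnth x j)].
  apply/seteqP; split=> x /=; rewrite /A.
    by move=> xi j; case: eqP => [->|].
  by move=> /(_ i); rewrite eqxx.
rewrite lebesgue_box.
  by rewrite (bigD1 i) //= /A eqxx lebesgue_measure_set1 mul0e.
by move=> j; rewrite /A; case: ifP => // _; exact: measurable_set1.
Qed.

Definition fscale n : R := (2 * pi) `^ (- (n%:R / 2)).

Lemma fscale_gt0 n : 0 < fscale n.
Proof. by rewrite /fscale powR_gt0 // mulr_gt0 // pi_gt0. Qed.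

Lemma fscale_sq n : fscale n * fscale n = ((2 * pi) ^+ n)^-1.
Proof.
rewrite /fscale -powRD; last by rewrite mulf_neq0 ?implybT // gt_eqF ?pi_gt0.
by rewrite -opprD -splitr powRN powR_mulrn // mulr_ge0 // pi_ge0.
Qed.

Lemma integrable_fmeas n (f : rspace R n -> R) :
  integrableR (fmeas R n) f <-> integrableR (L n) f.
Proof. by apply: integrableR_mscale; exact: fscale_gt0. Qed.

Lemma Rintegral_fmeas n (f : rspace R n -> R) : integrableR (L n) f ->
  \int[fmeas R n]_x f x = fscale n * \int[L n]_x f x.
Proof. by apply: Rintegral_mscale; exact: fscale_gt0. Qed.

Lemma fmeas_null n (A : set (rspace R n)) : L n A = 0%E -> fmeas R n A = 0%E.
Proof.
by move=> A0; change ((fscale n)%:E * L n A = 0)%E; rewrite A0 mule0.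
Qed.

End LebesgueRn.

(** * The Fourier transform of exp (- s |x|) *)

Section LaplaceKernel.
Variable R : realType.
Implicit Types (s u x y : R) (f g : R -> R).
Local Notation mu := (@lebesgue_measure R).

Lemma is_derive_mulr c x : is_derive x 1 (fun y => c * y) c.
Proof.
have := is_deriveZ c (is_derive_id x (1 : R)).
by rewrite /GRing.scale /= mulr1; exact.
Qed.

Lemma is_derive_comp_mulr f c x d : is_derive (c * x) 1 f d ->
  is_derive x 1 (fun y => f (c * y)) (d * c).
Proof. by move=> fd; exact: (is_derive1_comp fd (is_derive_mulr c x)). Qed.

Lemma is_deriveMR f g x df dg : is_derive x 1 f df -> is_derive x 1 g dg ->
  is_derive x 1 (fun y => f y * g y) (df * g x + f x * dg).
Proof.
move=> fd gd; rewrite addrC [df * _]mulrC.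
by have := is_deriveM fd gd; rewrite /GRing.scale /=; exact.
Qed.

Lemma is_deriveDR f g x df dg : is_derive x 1 f df -> is_derive x 1 g dg ->
  is_derive x 1 (fun y => f y + g y) (df + dg).
Proof. by move=> fd gd; exact: (is_deriveD fd gd). Qed.

Definition laplace s y : R := expR (- s * `|y|).

(** A primitive of [exp (- s y) (1 + cos (u y))] on the half-line.  Adding [1]
    makes the integrand nonnegative, as the fundamental theorem of calculus on an
    unbounded interval requires. *)
Let prim s u y : R := - s^-1 * expR (- s * y) +
  (s ^+ 2 + u ^+ 2)^-1 *
    (expR (- s * y) * (- s * cos (u * y) + u * sin (u * y))).

Let is_derive_prim s u x : 0 < s ->
  is_derive x 1 (prim s u) (expR (- s * x) * (1 + cos (u * x))).
Proof.
move=> s0.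
have de := is_derive_comp_mulr (is_derive_expR (- s * x)).
have dc := is_derive_comp_mulr (is_derive_cos (u * x)).
have ds := is_derive_comp_mulr (is_derive_sin (u * x)).
have cst (c : R) := is_derive_cst c x (1 : R).
have dcs := is_deriveDR (is_deriveMR (cst (- s)) dc) (is_deriveMR (cst u) ds).
have := is_deriveDR (is_deriveMR (cst (- s^-1)) de)
  (is_deriveMR (cst (s ^+ 2 + u ^+ 2)^-1) (is_deriveMR de dcs)).
move=> d; apply: is_derive_eq.
have s2 : s ^+ 2 + u ^+ 2 != 0.
  by rewrite gt_eqF // ltr_pwDl ?exprn_gt0 // sqr_ge0.
by rewrite /=; field; rewrite s2 gt_eqF.
Qed.

Let expRN_cvg0 s : 0 < s -> expR (- s * y) @[y --> +oo] --> 0.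
Proof.
move=> s0; have sy : s * y @[y --> +oo] --> +oo by exact: gt0_cvgMry.
under eq_fun do rewrite mulNr.
exact: (@cvg_comp _ _ _ (fun y => s * y) (fun y => expR (- y)) _ _ _ sy
  (@cvgr_expR R)).
Qed.

Let prim_cvg0 s u : 0 < s -> prim s u y @[y --> +oo] --> 0.
Proof.
move=> s0; set c := s^-1 + (s ^+ 2 + u ^+ 2)^-1 * (s + `|u|).
have e0 := expRN_cvg0 s0.
apply: (@squeeze_cvgr _ _ _ _ (fun y => - c * expR (- s * y))
    (fun y => c * expR (- s * y))).
- apply: nearW => y; rewrite mulNr -ler_norml /prim (mulrCA _ (expR _)).
  rewrite (mulrC _ (expR _)) -mulrDr normrM (ger0_norm (expR_ge0 _)) mulrC.
  rewrite ler_wpM2r ?expR_ge0 // (le_trans (ler_normD _ _)) //.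
  rewrite /c normrN (@ger0_norm _ s^-1) ?invr_ge0 ?(ltW s0) // lerD2l.
  rewrite normrM ger0_norm ?invr_ge0 ?addr_ge0 ?sqr_ge0 //.
  rewrite ler_wpM2l ?invr_ge0 ?addr_ge0 ?sqr_ge0 // (le_trans (ler_normD _ _)) //.
  rewrite !normrM normrN (gtr0_norm s0) lerD //.
    by rewrite ler_piMr ?(ltW s0) // ler_norml cos_geN1 cos_le1.
  by rewrite ler_piMr // ler_norml sin_geN1 sin_le1.
- by rewrite -[X in _ --> X](mulr0 (- c)); exact: cvgMl_tmp.
- by rewrite -[X in _ --> X](mulr0 c); exact: cvgMl_tmp.
Qed.

Lemma continuous_cosM u : continuous (fun x => cos (u * x)).
Proof.
by move=> x; apply: continuous_comp; [exact: mulrl_continuous|exact: continuous_cos].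
Qed.

Lemma continuous_sinM u : continuous (fun x => sin (u * x)).
Proof.
by move=> x; apply: continuous_comp; [exact: mulrl_continuous|exact: continuous_sin].
Qed.

Lemma continuous_laplace s : continuous (laplace s).
Proof.
move=> x; apply: continuous_comp; last exact: continuous_expR.
by apply: continuous_comp; [exact: norm_continuous|exact: mulrl_continuous].
Qed.

(** Folding the line at [0] reduces even and odd functions to the half-line. *)
Lemma integral_fold f : (forall x, 0 <= f x) -> continuous f ->
  (\int[mu]_x (f x)%:E =
   \int[mu]_(x in `[0%R, +oo[) (f x + f (- x))%R%:E)%E.
Proof.
move=> f0 cf; have mf := continuous_measurable_fun cf.
have cfN : continuous (f \o -%R).
  by move=> x; apply: continuous_comp; [exact: opp_continuous|exact: cf].
have mfN := continuous_measurable_fun cfN.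
rewrite -(setUv (`[0, +oo[%classic : set R)) ge0_integral_setU //=; last 4 first.
- exact: measurableC.
- by apply/measurable_EFinP; rewrite setUv.
- by move=> x _; rewrite lee_fin.
- exact/disj_setPCl.
rewrite setCitvr integral_itv_bndo_bndc; last exact/measurable_EFinP/measurable_funTS.
rewrite -{2}oppr0 ge0_integration_by_substitutionNy; last 2 first.
- exact: continuous_subspaceT.
- by move=> x _.
rewrite -ge0_integralD //=; do ?[exact/measurable_EFinP/measurable_funTS];
  do ?[by move=> x _; rewrite lee_fin].
Qed.

Let add1cos_ge0 x : 0 <= 1 + cos x.
Proof. by have := cos_geN1 x; lra. Qed.

Lemma integral_half_laplace s u : 0 < s ->
  (\int[mu]_(x in `[0%R, +oo[) (expR (- s * x) * (1 + cos (u * x)))%:E =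
   (s^-1 + s / (s ^+ 2 + u ^+ 2))%:E)%E.
Proof.
move=> s0; rewrite (@ge0_continuous_FTC2y _ _ (prim s u) _ 0).
- rewrite /prim !mulr0 expR0 cos0 sin0 -EFinB; congr EFin; ring.
- move=> x _; by rewrite mulr_ge0 ?expR_ge0 ?add1cos_ge0.
- apply: continuous_subspaceT => x; apply: cvgM.
    by apply: continuous_comp; [exact: mulrl_continuous|exact: continuous_expR].
  by apply: cvgD; [exact: cvg_cst|exact: continuous_cosM].
- exact: prim_cvg0.
- by move=> x _; have [] := is_derive_prim u x s0.
- apply: cvg_at_right_filter.
  have [d _] := is_derive_prim u 0 s0.
  exact/differentiable_continuous/derivable1_diffP.
- move=> x _; rewrite derive1E; have d := is_derive_prim u x s0.
  exact: derive_val.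
Qed.

Lemma laplace_ge0 s x : 0 <= laplace s x.
Proof. exact: expR_ge0. Qed.

Lemma laplace_opp s x : laplace s (- x) = laplace s x.
Proof. by rewrite /laplace normrN. Qed.

Lemma integral_laplace_cos1 s u : 0 < s ->
  (\int[mu]_x (laplace s x * (1 + cos (u * x)))%:E =
   (2 * (s^-1 + s / (s ^+ 2 + u ^+ 2)))%:E)%E.
Proof.
move=> s0.
have mf : measurable_fun (`[0, +oo[%classic : set (measurableTypeR R))
    (EFin \o (fun x => expR (- s * x) * (1 + cos (u * x)))).
  apply/measurable_EFinP/measurable_funTS; apply: continuous_measurable_fun => x.
  apply: cvgM; last by apply: cvgD; [exact: cvg_cst|exact: continuous_cosM].
  by apply: continuous_comp; [exact: mulrl_continuous|exact: continuous_expR].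
rewrite integral_fold.
- rewrite EFinM -integral_half_laplace // -ge0_integralZl_EFin //=;
    do ?[by move=> x _; rewrite lee_fin mulr_ge0 ?expR_ge0 ?add1cos_ge0].
  apply: eq_integral => x; rewrite inE /= in_itv /= andbT => x0.
  rewrite laplace_opp mulrN cosN /laplace ger0_norm // -EFinM; congr EFin; ring.
- by move=> x; rewrite mulr_ge0 ?laplace_ge0 ?add1cos_ge0.
- move=> x; apply: cvgM; first exact: continuous_laplace.
  by apply: cvgD; [exact: cvg_cst|exact: continuous_cosM].
Qed.

Lemma integrable_laplace_cos1 s u : 0 < s ->
  integrableR mu (fun x => laplace s x * (1 + cos (u * x))).
Proof.
move=> s0; apply/integrableP; split.
  apply/measurable_EFinP; apply: continuous_measurable_fun => x.
  apply: cvgM; first exact: continuous_laplace.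
  by apply: cvgD; [exact: cvg_cst|exact: continuous_cosM].
under eq_integral => x _.
  rewrite /= ger0_norm ?mulr_ge0 ?laplace_ge0 ?add1cos_ge0 //.
  over.
by rewrite integral_laplace_cos1 // ltry.
Qed.

Lemma Rintegral_laplace_cos1 s u : 0 < s ->
  \int[mu]_x (laplace s x * (1 + cos (u * x))) =
  2 * (s^-1 + s / (s ^+ 2 + u ^+ 2)).
Proof. by move=> s0; rewrite /Rintegral integral_laplace_cos1. Qed.

Lemma integrable_laplace s : 0 < s -> integrableR mu (laplace s).
Proof.
move=> s0; have := integrableRZ 2^-1 (integrable_laplace_cos1 0 s0).
congr (_.-integrable _ (EFin \o _)); apply/funext => x.
by rewrite mul0r cos0 mulrCA -[1 + 1]/2 mulVf ?mulr1.
Qed.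

Lemma Rintegral_laplace s : 0 < s -> \int[mu]_x laplace s x = 2 / s.
Proof.
move=> s0; have := Rintegral_laplace_cos1 0 s0.
under eq_Rintegral do rewrite mul0r cos0 mulrC.
rewrite RintegralZl //; last exact: integrable_laplace.
have s1 : s != 0 by rewrite gt_eqF.
rewrite expr0n addr0 => E.
by apply: (@mulfI _ (1 + 1)) => //; rewrite E; field.
Qed.

Lemma measurable_laplace s : measurable_fun setT (laplace s).
Proof. exact: continuous_measurable_fun (@continuous_laplace s). Qed.

Lemma integrable_laplace_cos s u : 0 < s ->
  integrableR mu (fun x => laplace s x * cos (u * x)).
Proof.
move=> s0; apply: (integrableR_le _ _ (integrable_laplace s0)).
  apply: measurable_funM; first exact: measurable_laplace.
  by apply: continuous_measurable_fun; exact: continuous_cosM.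
move=> x; rewrite normrM ger0_norm ?laplace_ge0 // ler_piMr ?laplace_ge0 //.
by rewrite ler_norml cos_geN1 cos_le1.
Qed.

Lemma integrable_laplace_sin s u : 0 < s ->
  integrableR mu (fun x => laplace s x * sin (u * x)).
Proof.
move=> s0; apply: (integrableR_le _ _ (integrable_laplace s0)).
  apply: measurable_funM; first exact: measurable_laplace.
  by apply: continuous_measurable_fun; exact: continuous_sinM.
move=> x; rewrite normrM ger0_norm ?laplace_ge0 // ler_piMr ?laplace_ge0 //.
by rewrite ler_norml sin_geN1 sin_le1.
Qed.

Lemma Rintegral_laplace_cos s u : 0 < s ->
  \int[mu]_x (laplace s x * cos (u * x)) = 2 * s / (s ^+ 2 + u ^+ 2).
Proof.
move=> s0; have := Rintegral_laplace_cos1 u s0.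
under eq_Rintegral do rewrite mulrDr mulr1.
rewrite RintegralD //; [|exact: integrable_laplace|exact: integrable_laplace_cos].
rewrite Rintegral_laplace // mulrDr !mulrA => /addrI; exact.
Qed.

(** Folded at [0], the integrands [laplace s x * (1 + sin (u * x))] and
    [laplace s x] coincide, the sine being odd. *)
Lemma Rintegral_laplace_sin s u : 0 < s ->
  \int[mu]_x (laplace s x * sin (u * x)) = 0.
Proof.
move=> s0.
have c1 : continuous (fun x => laplace s x * (1 + sin (u * x))).
  move=> x; apply: cvgM; first exact: continuous_laplace.
  by apply: cvgD; [exact: cvg_cst|exact: continuous_sinM].
have p1 x : 0 <= laplace s x * (1 + sin (u * x)).
  by rewrite mulr_ge0 ?laplace_ge0 //; have := sin_geN1 (u * x); lra.
have : \int[mu]_x (laplace s x * (1 + sin (u * x))) = \int[mu]_x laplace s x.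
  rewrite /Rintegral !integral_fold //; last exact: continuous_laplace.
    congr fine; apply: eq_integral => x _; congr EFin.
    rewrite laplace_opp mulrN sinN; ring.
  by move=> x; exact: laplace_ge0.
under eq_Rintegral do rewrite mulrDr mulr1.
rewrite RintegralD //; [|exact: integrable_laplace|exact: integrable_laplace_sin].
by rewrite -[RHS]addr0 => /addrI.
Qed.

End LaplaceKernel.

(** * The Poisson kernel on the line *)

Section PoissonKernel.
Variable R : realType.
Implicit Types (s x a b z : R).
Local Notation mu := (@lebesgue_measure R).

Definition poisson s x : R := s / (pi * (s ^+ 2 + x ^+ 2)).

(** A primitive of [poisson s]. *)
Definition step s x : R := atan (x / s) / pi.

Let den_gt0 s x : 0 < s -> 0 < s ^+ 2 + x ^+ 2.
Proof. by move=> s0; rewrite ltr_pwDl ?exprn_gt0 // sqr_ge0. Qed.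

Lemma is_derive_step s z x : 0 < s ->
  is_derive x 1 (fun y => step s (y - z)) (poisson s (x - z)).
Proof.
move=> s0; have s1 : s != 0 by rewrite gt_eqF.
have da : is_derive x 1 (fun y => y - z) (1 + 0).
  exact: is_deriveDR (is_derive_id _ _) (is_derive_cst _ _ _).
have db := @is_derive1_comp _ (fun y => s^-1 * y) (fun y => y - z) x _ _
  (is_derive_mulr s^-1 (x - z)) da.
have dc := @is_derive1_comp _ atan (fun y => s^-1 * (y - z)) x _ _
  (is_derive1_atan (s^-1 * (x - z))) db.
have dd := @is_derive1_comp _ (fun y => pi^-1 * y)
  (fun y => atan (s^-1 * (y - z))) x _ _ (is_derive_mulr pi^-1 _) dc.
rewrite (_ : (fun y => _) = (fun y => pi^-1 * atan (s^-1 * (y - z)))); last first.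
  by apply/funext => y; rewrite /step /= mulrC (mulrC s^-1).
apply: (@is_derive_eq _ _ _ _ _ _ _ _ dd).
have p1 : (pi : R) != 0 by rewrite gt_eqF ?pi_gt0.
have d1 : s ^+ 2 + (x - z) ^+ 2 != 0 by rewrite gt_eqF ?den_gt0.
rewrite /poisson addr0 mulr1; move: (pi : R) p1 => p p1.
by field; rewrite d1 p1 s1.
Qed.

Lemma poisson_ge0 s x : 0 < s -> 0 <= poisson s x.
Proof.
by move=> s0; rewrite divr_ge0 ?ltW // mulr_gt0 ?pi_gt0 ?den_gt0.
Qed.

Lemma poisson_le s x : 0 < s -> poisson s x <= (pi * s)^-1.
Proof.
move=> s0; rewrite /poisson ler_pdivrMr ?mulr_gt0 ?pi_gt0 ?den_gt0 //.
rewrite invfM mulrACA mulVf ?gt_eqF ?pi_gt0 // mul1r expr2 mulrDr mulKf ?gt_eqF //.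
by rewrite lerDl mulr_ge0 ?invr_ge0 ?sqr_ge0 // ltW.
Qed.

Lemma continuous_poisson s : 0 < s -> continuous (poisson s).
Proof.
move=> s0 x; apply: cvgM; first exact: cvg_cst.
apply: cvgV; first by rewrite mulf_neq0 // gt_eqF ?pi_gt0 ?den_gt0.
apply: cvgM; first exact: cvg_cst.
apply: cvgD; first exact: cvg_cst.
exact: exprn_continuous.
Qed.

Lemma step_bound s x : `|step s x| <= 2^-1.
Proof.
rewrite /step normrM normfV (ger0_norm (pi_ge0 R)) ler_pdivrMr ?pi_gt0 //.
rewrite [2^-1 * _]mulrC ler_norml; apply/andP; split; apply: ltW.
  exact: atan_gtNpi2.
exact: atan_ltpi2.
Qed.

Lemma integral_poisson s a b z : 0 < s -> a < b ->
  \int[mu]_x (\1_(`[a, b]%classic : set R) x * poisson s (x - z)) =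
  step s (b - z) - step s (a - z).
Proof.
move=> s0 ab; rewrite /Rintegral.
transitivity (fine (\int[mu]_(x in `[a, b]) (poisson s (x - z))%:E)%E).
  congr fine; rewrite [RHS]integral_mkcond; apply: eq_integral => x _.
  by rewrite patchE indicE; case: ifP => _; rewrite ?mul1r ?mul0r.
have dS x : derivable (fun y => step s (y - z)) x 1.
  by have [] := is_derive_step z x s0.
have cS : continuous (fun y => step s (y - z)).
  move=> x; apply/differentiable_continuous/derivable1_diffP; exact: dS.
rewrite (@continuous_FTC2 _ _ (fun y => step s (y - z))) //.
- apply: continuous_subspaceT => x.
  apply: (@continuous_comp _ _ _ (fun x => x - z) (poisson s)).
    by apply: cvgB; [exact: cvg_id|exact: cvg_cst].
  exact: continuous_poisson.
- split; first by move=> x _; exact: dS.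
  + by apply: cvg_at_right_filter; exact: cS.
  + by apply: cvg_at_left_filter; exact: cS.
- move=> x _; rewrite derive1E; have d := is_derive_step z x s0.
  exact: derive_val.
Qed.

Lemma integrable_poisson s a b z : 0 < s ->
  integrableR mu (fun x => \1_(`[a, b]%classic : set R) x * poisson s (x - z)).
Proof.
move=> s0.
rewrite (_ : (fun x => _) =
    fun x => poisson s (x - z) * \1_(`[a, b]%classic : set R) x); last first.
  by apply/funext => x; rewrite mulrC.
apply: (@integrableRM_bounded _ _ _ _ _ _ (pi * s)^-1).
- exact: integrable_indic_itv.
- apply: continuous_measurable_fun => x.
  apply: (@continuous_comp _ _ _ (fun x => x - z) (poisson s)).
    by apply: cvgB; [exact: cvg_id|exact: cvg_cst].
  exact: continuous_poisson.
- by move=> x; rewrite ger0_norm ?poisson_ge0 // poisson_le.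
Qed.

Lemma step_cvg x : (fun k => step k.+1%:R^-1 x) @ \oo --> Num.sg x / 2.
Proof.
have kx y : 0 < y -> (fun k => step k.+1%:R^-1 y) @ \oo --> (1 / 2 : R).
  move=> y0; have -> : (1 / 2 : R) = (pi / 2) / pi.
    by rewrite mulrAC divff // gt_eqF // pi_gt0.
  under eq_fun do rewrite /step invrK.
  apply: cvgMr_tmp.
  have yk : (fun k => y * k.+1%:R) @ \oo --> +oo.
    have nk : (fun k => k.+1%:R : R) @ \oo --> +oo.
      by rewrite (cvg_shiftS (fun k => k%:R : R)); exact: cvgr_idn.
    have yt : y * t @[t --> +oo] --> +oo by exact: gt0_cvgMry.
    exact: (cvg_comp _ _ nk yt).
  exact: (cvg_comp _ _ yk (@cvgy_atan R)).
case: (ltgtP x 0) => x0.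
- rewrite ltr0_sg // mulNr -[x]opprK.
  rewrite (_ : (fun k => _) = fun k => - step k.+1%:R^-1 (- x)).
    by apply: cvgN; apply: kx; rewrite oppr_gt0.
  by apply/funext => k; rewrite opprK /step mulNr atanN mulNr opprK.
- by rewrite gtr0_sg //; exact: kx.
- rewrite x0 sgr0 mul0r; under eq_fun do rewrite /step mul0r atan0 mul0r.
  exact: cvg_cst.
Qed.

End PoissonKernel.

(** * Integrals over boxes determine a function *)

Section Boxes.
Variables (R : realType) (n : nat).
Local Notation L := (lebesgue R n).
Local Notation T := (rspace R n).
Implicit Types (x : T).

Definition orthant (b : 'I_n -> \bar R) : set T :=
  [set x | forall i, ((tnth x i)%:E <= b i)%E].

Lemma measurable_all_coord (A : 'I_n -> set (measurableTypeR R)) :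
  (forall i, measurable (A i)) ->
  measurable [set x : T | forall i, A i (tnth x i)].
Proof.
move=> mA; have -> : [set x : T | forall i, A i (tnth x i)] =
    \bigcap_(i in [set: 'I_n]) ((@tnth _ _)^~ i @^-1` A i).
  by apply/seteqP; split=> x Px i => [_|]; exact: Px.
apply: fin_bigcap_measurable => // i _; rewrite -[X in measurable X]setTI.
exact: measurable_tnth.
Qed.

Lemma measurable_orthant (b : 'I_n -> \bar R) : measurable (orthant b).
Proof.
apply: (measurable_all_coord (A := fun i => [set t | (t%:E <= b i)%E])) => i.
case: (b i) => [r||].
- rewrite (_ : [set _ | _] = `]-oo, r]%classic); first exact: measurable_itv.
  by apply/seteqP; split=> t /=; rewrite in_itv /= lee_fin.
- rewrite (_ : [set _ | _] = setT) //.
  by apply/seteqP; split=> t //= _; exact: leey.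
- rewrite (_ : [set _ | _] = set0) //.
  by apply/seteqP; split=> t //=; rewrite leeNy_eq.
Qed.

(** Bounds in the extended reals make the orthants stable under intersection while
    giving half-spaces among them, which is enough to generate. *)
Lemma measurable_orthants : @measurable _ T = <<s range orthant >>.
Proof.
apply/seteqP; split; last first.
  apply: smallest_sub; first exact: sigma_algebra_measurable.
  by move=> _ [b _ <-]; exact: measurable_orthant.
apply: smallest_sub; first exact: smallest_sigma_algebra.
apply: (big_ind (fun F => F `<=` <<s range orthant >>))
  => [//|A B sA sB C [/sA|/sB]//|i _ _ [B mB <-]].
pose Tg := g_sigma_algebraType (range orthant).
have mt : measurable_fun [set: Tg] (fun x : Tg => tnth (x : T) i).
  apply: (measurability _ (RGenOInfty.measurableE R)) => _ [_ [r ->] <-].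
  rewrite setTI -[X in measurable X]setCK; apply: measurableC.
  apply: sub_sigma_algebra; exists (fun j => if j == i then r%:E else +oo%E) => //.
  apply/seteqP; split=> x; rewrite /orthant /= in_itv /= andbT.
    by move=> /(_ i); rewrite eqxx lee_fin leNgt => /negP.
  by move=> /negP; rewrite -leNgt => xr j; case: eqP => [->|]; rewrite ?leey.
exact: mt.
Qed.

Lemma setI_closed_orthants : setI_closed (range orthant).
Proof.
move=> _ _ [b _ <-] [c _ <-]; exists (fun i => mine (b i) (c i)) => //.
apply/seteqP; split=> x /=; rewrite /orthant /=.
  by move=> h; split=> i; have := h i; rewrite le_min => /andP[].
by move=> [hb hc] i; rewrite le_min hb hc.
Qed.

Definition ibox (a b : 'I_n -> R) x : R :=
  \prod_i \1_(`[a i, b i]%classic : set R) (tnth x i).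

Lemma iboxE a b x : ibox a b x = (`[< forall i, a i <= tnth x i <= b i >])%:R.
Proof.
rewrite /ibox; case: asboolP => [h|/existsNP[i hi]].
  by rewrite big1 // => i _; rewrite indicE mem_set //= in_itv /= h.
rewrite (bigD1 i) //= indicE memNset ?mul0r //= in_itv /=; exact/negP.
Qed.

Lemma ibox_ge0 a b x : 0 <= ibox a b x.
Proof. by rewrite iboxE. Qed.

Lemma measurable_ibox a b : measurable_fun setT (ibox a b).
Proof.
apply: (measurable_prod_tnth (g := fun i => \1_(`[a i, b i]%classic : set R))).
by move=> i; exact: measurable_indic.
Qed.

Lemma integrable_ibox a b : integrableR L (ibox a b).
Proof.
apply: (lebesgue_integral_prod
  (g := fun i => \1_(`[a i, b i]%classic : set R)) _).1.
by move=> i; exact: integrable_indic_itv.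
Qed.

Lemma measurable_hyperplane i (r : R) : measurable [set x : T | tnth x i = r].
Proof.
rewrite (_ : [set _ | _] = (@tnth _ _)^~ i @^-1` [set r]) //.
by rewrite -[X in measurable X]setTI; exact: measurable_tnth.
Qed.

Lemma hyperplanes_null (c : 'I_n -> R) :
  measurable [set x : T | exists i, tnth x i = c i] /\
  L [set x : T | exists i, tnth x i = c i] = 0%E.
Proof.
apply: (fin_bigcup_null (N := fun i => [set x : T | tnth x i = c i])) => i.
- exact: measurable_hyperplane.
- exact: lebesgue_hyperplane.
Qed.

(** Orthants form a pi-system generating the Borel sets, and an orthant meets a cube
    in a nondegenerate box or in a null set.  So on each cube the lambda-system of
    the sets over which the integral of [g] vanishes contains every Borel set. *)
Lemma ae0_of_boxes (g : T -> R) : measurable_fun setT g ->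
  (forall a b, (forall i, a i < b i) ->
     integrableR L (fun x => ibox a b x * g x) /\
     \int[L]_x (ibox a b x * g x) = 0) ->
  exists N, [/\ measurable N, L N = 0%E & forall x, ~ N x -> g x = 0].
Proof.
move=> mg g0; pose q (k : nat) (_ : 'I_n) : R := k.+1%:R.
pose m k (_ : 'I_n) : R := - k.+1%:R.
have mq k (i : 'I_n) : m k i < q k i by rewrite /m /q gtrN.
pose gk k x := ibox (m k) (q k) x * g x.
have igk k : integrableR L (gk k) by have [] := g0 _ _ (mq k).
have gk0 k : exists N, [/\ measurable N, L N = 0%E & forall x, ~ N x -> gk k x = 0].
  have gkA A : measurable A -> (\int[L]_(x in A) (gk k x)%:E = 0)%E.
    have iS (B : set T) : measurable B -> L.-integrable B (EFin \o gk k).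
      by move=> mB; exact: integrableS (igk k).
    have T0 : (\int[L]_x (gk k x)%:E = 0)%E.
      by rewrite -EFin_Rintegral // (g0 _ _ (mq k)).2.
    rewrite measurable_orthants; move: A.
    apply: (dynkin_induction measurable_orthants setI_closed_orthants) => //.
    - move=> _ [b _ <-].
      rewrite integral_mkcond.
      (* If some bound is at most the lower bound of the cube, the orthant meets
         the cube inside a hyperplane. *)
      have [bm|/existsNP[i /negP]] :=
          pselect (forall i, ((m k i)%:E < b i)%E); last first.
        rewrite -leNgt => bi; rewrite -[RHS](integral0 L setT).
        apply: (integral_off_null _ (lebesgue_hyperplane i (m k i))).
          exact: measurable_hyperplane.
        move=> x xi; rewrite patchE; case: ifPn => //; rewrite inE => /(_ i) xb.
        rewrite /= /gk iboxE; case: asboolP => [/(_ i) /andP[mx _]|_].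
          case: xi => /=; apply/eqP; rewrite eq_le mx andbT.
          by rewrite -lee_fin (le_trans xb).
        by rewrite mul0r.
      pose b' i : R := fine (mine (b i) (q k i)%:E).
      have b'E i : (b' i)%:E = mine (b i) (q k i)%:E.
        rewrite /b' fineK //; have := bm i.
        by case: (b i) => [r||] // _; rewrite ?minEle /=; case: ifP.
      have mb' i : m k i < b' i by rewrite -lte_fin b'E lt_min bm lte_fin mq.
      have [ib ib0] := g0 _ _ mb'.
      rewrite -[RHS]/(0%:E) -ib0 EFin_Rintegral //; apply: eq_integral => x _.
      rewrite patchE /= /gk !iboxE.
      have E : orthant b x /\ (forall i, m k i <= tnth x i <= q k i) <->
          forall i, m k i <= tnth x i <= b' i.
        have xb i : (tnth x i <= b' i) =
            ((tnth x i)%:E <= b i)%E && (tnth x i <= q k i).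
          by rewrite -lee_fin b'E le_min lee_fin.
        split=> [[ob mx] i|mx]; first by rewrite xb ob.
        by split=> i; have := mx i; rewrite xb => /and3P[h1 h2 h3]; rewrite ?h1.
      case: E => E1 E2; case: ifPn => [/set_mem|/negP] ob; last first.
        by rewrite asboolF ?mul0r // => /E2[/mem_set].
      congr ((_%:R * _)%:E); congr (nat_of_bool _); apply/idP/idP => /asboolP h.
        by apply/asboolP/E1.
      by apply/asboolP; case/E2: h.
    - move=> S mS S0; rewrite -[LHS]add0e -{1}S0 -integral_setU //.
      + by rewrite setUv.
      + exact: measurableC.
      + by rewrite setUv; have /integrableP[] := igk k.
      + exact/disj_setPCl.
    - move=> F mF tF F0; rewrite integral_bigcup //; last first.
        by apply: iS; exact: bigcupT_measurable.
      by rewrite eseries0.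
  have [N [mN N0 sN]] : ae_eq L setT (EFin \o gk k) (cst 0%E).
    apply: integral_ae_eq => //.
    by move=> E _ mE; rewrite gkA // integral0.
  exists N; split => // x Nx; apply/eqP; apply: contra_notT Nx => /eqP gx.
  by apply: sN => /= /(_ I) [].
have [N NP] := choice gk0.
exists (\bigcup_k N k); split.
- by apply: bigcupT_measurable => k; case: (NP k).
- apply/negligibleP; first by apply: bigcupT_measurable => k; case: (NP k).
  by apply: negligible_bigcup => k; have [? ? _] := NP k; apply/negligibleP.
- move=> x Nx; pose k := (\max_i Num.truncn `|tnth x i|)%N.
  have [_ _ /(_ x)] := NP k.
  rewrite /gk iboxE; case: asboolP => [_|[]]; last first.
    move=> i; rewrite -ler_norml /q; apply: le_trans (ltW (truncnS_gt _)) _.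
    by rewrite ler_nat ltnS (leq_bigmax i).
  by rewrite mul1r; apply; apply: contra_not Nx => Nx; exists k.
Qed.

End Boxes.

(** * Poisson smoothing on R^n *)

Section PoissonSmoothing.
Variables (R : realType) (n : nat).
Local Notation L := (lebesgue R n).
Local Notation T := (rspace R n).
Implicit Types (x z : T) (f : T -> R).

Definition eps k : R := k.+1%:R^-1.

Lemma eps_gt0 k : 0 < eps k.
Proof. by rewrite invr_gt0. Qed.

Definition poissonN k x z : R := \prod_i poisson (eps k) (tnth x i - tnth z i).

Definition smooth f k x : R := \int[L]_z (poissonN k x z * f z).

Lemma measurable_coord_sub i :
  measurable_fun setT (fun p : T * T => tnth p.1 i - tnth p.2 i).
Proof.
apply: measurable_funB.
- exact: (measurableT_comp (measurable_tnth i) measurable_fst).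
- exact: (measurableT_comp (measurable_tnth i) measurable_snd).
Qed.

Lemma measurable_poissonN k :
  measurable_fun setT (fun p : T * T => poissonN k p.1 p.2).
Proof.
apply: measurable_prod => i _.
have mp : measurable_fun setT (poisson (eps k)).
  by apply: continuous_measurable_fun; apply: continuous_poisson; exact: eps_gt0.
exact: (measurableT_comp mp (measurable_coord_sub i)).
Qed.

Lemma poissonN_ge0 k x z : 0 <= poissonN k x z.
Proof. by apply: prodr_ge0 => i _; apply: poisson_ge0; exact: eps_gt0. Qed.

Lemma poissonN_le k x z : poissonN k x z <= (pi * eps k)^-1 ^+ n.
Proof.
rewrite -[n in _ ^+ n]card_ord -prodr_const; apply: ler_prod => i _.
by rewrite poisson_ge0 ?poisson_le ?eps_gt0.
Qed.

Lemma integrable_poissonN f k x : integrableR L f ->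
  integrableR L (fun z => poissonN k x z * f z).
Proof.
move=> intf; apply: (@integrableRM_bounded _ _ _ _ _ _ ((pi * eps k)^-1 ^+ n)) => //.
- exact: (measurable_slice1 (@measurable_poissonN k)).
- by move=> z; rewrite ger0_norm ?poissonN_ge0 ?poissonN_le.
Qed.

Section SmoothBox.
Variables (f : T -> R) (a b : 'I_n -> R) (k : nat).
Hypotheses (intf : integrableR L f) (ab : forall i, a i < b i).

Let F x z := ibox a b x * (poissonN k x z * f z).

Let mF : measurable_fun setT (fun p : T * T => F p.1 p.2).
Proof.
apply: measurable_funM.
  exact: (measurableT_comp (measurable_ibox a b) measurable_fst).
apply: measurable_funM; first exact: measurable_poissonN.
exact: (measurableT_comp (integrableR_measurable intf) measurable_snd).
Qed.

Let Fle x z : `|F x z| <= ibox a b x * ((pi * eps k)^-1 ^+ n * `|f z|).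
Proof.
rewrite /F normrM ger0_norm ?ibox_ge0 // ler_wpM2l ?ibox_ge0 // normrM.
by rewrite ger0_norm ?poissonN_ge0 // ler_wpM2r // poissonN_le.
Qed.

Let iv := integrableRZ ((pi * eps k)^-1 ^+ n) (integrable_norm intf).

Lemma integrable_box_smooth :
  integrableR L (fun x => ibox a b x * smooth f k x).
Proof.
have := integrable_Rintegral mF Fle (integrable_ibox a b) iv.
congr (_.-integrable _ (EFin \o _)); apply/funext => x.
by rewrite /F RintegralZl //; exact: integrable_poissonN.
Qed.

(** Fubini's theorem moves the smoothing from [f] to the indicator of the box, and
    the integral of the kernel over a box factors. *)
Lemma integral_box_smooth :
  \int[L]_x (ibox a b x * smooth f k x) =
  \int[L]_z (\prod_i (step (eps k) (b i - tnth z i) -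
                      step (eps k) (a i - tnth z i)) * f z).
Proof.
transitivity (\int[L]_x \int[L]_z F x z).
  by apply: eq_Rintegral => x _; rewrite /F RintegralZl //;
    exact: integrable_poissonN.
rewrite (Rintegral_swap mF Fle (integrable_ibox a b) iv).
apply: eq_Rintegral => z _; rewrite /F.
pose g i (t : measurableTypeR R) := \1_(`[a i, b i]%classic : set R) t *
  poisson (eps k) (t - tnth z i).
have ig i : integrableR (@lebesgue_measure R) (g i).
  by apply: integrable_poisson; exact: eps_gt0.
have [iP EP] := lebesgue_integral_prod ig.
under eq_Rintegral => x _.
  rewrite mulrA [ibox _ _ _ * _](_ : _ = \prod_i g i (tnth x i)); last first.
    by rewrite /ibox /poissonN -big_split.
  over.
rewrite RintegralZr // EP; congr (_ * _); apply: eq_bigr => i _.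
by rewrite integral_poisson ?eps_gt0.
Qed.

End SmoothBox.

(** The integral of the Poisson kernel over an interval is bounded by [1] and tends
    to the indicator of the interval, except at its end points; as [f] is
    integrable, dominated convergence applies without any regularity of [f]. *)
Lemma cvg_box_smooth f a b : integrableR L f -> (forall i, a i < b i) ->
  (fun k => \int[L]_x (ibox a b x * smooth f k x)) @ \oo -->
  \int[L]_x (ibox a b x * f x).
Proof.
move=> intf ab.
(* Each factor is the indicator of an interval, except for the value 1/2 at the
   end points: this is the limit of the integrals of the Poisson kernel. *)
pose lim x : R := \prod_i (Num.sg (b i - tnth x i) / 2 -
                           Num.sg (a i - tnth x i) / 2).
have -> : \int[L]_x (ibox a b x * f x) = \int[L]_x (lim x * f x).
  have [[ma a0] [mb b0]] := (hyperplanes_null a, hyperplanes_null b).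
  rewrite /Rintegral; congr fine.
  apply: (integral_off_null (measurableU _ _ ma mb) (null_set_setU ma mb a0 b0)).
  move=> x Nx; congr ((_ * _)%:E).
  apply: eq_bigr => i _.
  have xa : tnth x i != a i by apply/eqP => E; apply: Nx; left; exists i.
  have xb : tnth x i != b i by apply/eqP => E; apply: Nx; right; exists i.
  have abi := ab i; rewrite indicE.
  have -> : (tnth x i \in `[a i, b i]%classic) = (a i <= tnth x i <= b i).
    by apply/idP/idP; rewrite inE /= in_itv.
  case: (ltgtP (tnth x i) (a i)) xa => // xa _.
    rewrite !gtr0_sg ?subr_gt0 // ?(lt_trans xa) //=; lra.
  case: (ltgtP (tnth x i) (b i)) xb => // xb _.
    rewrite gtr0_sg ?subr_gt0 // ltr0_sg ?subr_lt0 //=; lra.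
  rewrite !ltr0_sg ?subr_lt0 //=; lra.
under eq_fun do rewrite integral_box_smooth //.
have mf := integrableR_measurable intf.
have mstep c k i : measurable_fun setT (fun x : T => step (eps k) (c - tnth x i)).
  have ms : measurable_fun setT (fun t : measurableTypeR R => step (eps k) (c - t)).
    apply: continuous_measurable_fun => t; apply: cvgM; last exact: cvg_cst.
    apply: (@continuous_comp _ _ _ (fun t => (c - t) / eps k) atan).
      apply: cvgM; last exact: cvg_cst.
      by apply: cvgB; [exact: cvg_cst|exact: cvg_id].
    exact: continuous_atan.
  exact: (measurableT_comp ms (measurable_tnth i)).
have mk k : measurable_fun setT (fun x : T => \prod_i
    (step (eps k) (b i - tnth x i) - step (eps k) (a i - tnth x i)) * f x).
  apply: measurable_funM => //; apply: measurable_prod => i _.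
  by apply: measurable_funB; exact: mstep.
have cl x : (fun k => \prod_i (step (eps k) (b i - tnth x i) -
    step (eps k) (a i - tnth x i)) * f x) @ \oo --> lim x * f x.
  apply: cvgMr_tmp; apply: cvg_big => [|i _].
    exact: mul_continuous.
  by apply: cvgB; exact: step_cvg.
apply: (Rintegral_dominated_cvg (u := fun x => `|f x|)).
- exact: mk.
- by apply: (measurable_fun_cvg mk) => x _; exact: cl.
- exact: cl.
- exact: integrable_norm.
- move=> k x; rewrite normrM ler_piMl // normr_prod prodr_ile1 // => i _.
  rewrite normr_ge0 /= (le_trans (ler_normB _ _)) //.
  by rewrite [leRHS](splitr 1) lerD // (le_trans (step_bound _ _)) // div1r.
Qed.

(** Being uniformly bounded, the smoothings of [f] also converge to [h] in the
    integral over any box; by [cvg_box_smooth], [f] and [h] then have the same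
    integrals over boxes. *)
Lemma smooth_limit_ae f (h : T -> R) (M : R) : integrableR L f ->
  (forall x, smooth f ^~ x @ \oo --> h x) ->
  (forall k x, `|smooth f k x| <= M) ->
  exists N, [/\ measurable N, L N = 0%E & forall x, ~ N x -> f x = h x].
Proof.
move=> intf sh sM; have mf := integrableR_measurable intf.
(* Only the product of a smoothing and a box is known to be measurable: let the
   box grow with the index. *)
have mh : measurable_fun setT h.
  apply: (measurable_fun_cvg (h := fun k x =>
    ibox (fun=> - k.+1%:R) (fun=> k.+1%:R) x * smooth f k x)) => [k|x _].
    apply: integrableR_measurable; apply: integrable_box_smooth => // i.
  rewrite -[h x]mul1r; apply: cvgM (sh x); apply: cvg_near_cst.
  exists (\max_i Num.truncn `|tnth x i|)%N => // k /= kx.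
  rewrite iboxE; case: asboolP => // -[] i; rewrite -ler_norml.
  apply: le_trans (ltW (Num.Theory.truncnS_gt _)) _.
  by rewrite ler_nat ltnS (leq_trans _ kx) // (leq_bigmax i).
have hM x : `|h x| <= M.
  have c : (fun k => `|smooth f k x|) @ \oo --> `|h x| by exact: cvg_norm (sh x).
  rewrite -(cvg_lim _ c) //.
  by apply: limr_le; [exact: cvgP c|exact: nearW].
have [||N [mN N0 fh]] := @ae0_of_boxes R n (fun x => f x - h x).
- exact: measurable_funB.
- move=> a b ab.
  have ibf : integrableR L (fun x => ibox a b x * f x).
    apply: (@integrableRM_bounded _ _ _ _ _ _ 1) => //.
      exact: measurable_ibox.
    by move=> x; rewrite ger0_norm ?ibox_ge0 // iboxE lern1 leq_b1.
  have iM : integrableR L (fun x => M * ibox a b x).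
    by apply: integrableRZ; exact: integrable_ibox.
  have bM g : (forall x, `|g x| <= M) ->
      forall x, `|ibox a b x * g x| <= M * ibox a b x.
    move=> gM x; rewrite mulrC normrM (ger0_norm (ibox_ge0 _ _ _)).
    by rewrite ler_wpM2r ?ibox_ge0.
  have ibh : integrableR L (fun x => ibox a b x * h x).
    apply: integrableR_le iM; last exact: bM.
    by apply: measurable_funM => //; exact: measurable_ibox.
  rewrite (_ : (fun x => _ * (f x - h x)) =
    fun x => ibox a b x * f x - ibox a b x * h x); last first.
    by apply/funext => x; rewrite mulrBr.
  split; first exact: (integrableB measurableT ibf ibh).
  rewrite RintegralB //; apply/eqP; rewrite subr_eq0; apply/eqP.
  apply: cvg_unique (cvg_box_smooth intf ab) _ => //.
  apply: (Rintegral_dominated_cvg (u := fun x => M * ibox a b x)) => //.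
  + move=> k; apply: integrableR_measurable; exact: integrable_box_smooth.
  + exact: (integrableR_measurable ibh).
  + by move=> x; apply: cvgMl_tmp; exact: sh.
  + by move=> k; apply: bM => x; exact: sM.
exists N; split => // x /fh /eqP; rewrite subr_eq0 => /eqP; exact.
Qed.

End PoissonSmoothing.

(** * Clifford-Fourier transforms of Borel functions *)

Section SidedProduct.
Variables (R : realType) (n : nat).
Local Notation G := (clifford R (n + n)).
Local Notation B := (@bivec R n).
Implicit Types (l : bool) (a v : G).

(** One proof for both transforms: [l] tells whether [a] multiplies on the left. *)
Definition smul l a v : G := if l then a * v else v * a.

Lemma smul1 l v : smul l 1 v = v.
Proof. by case: l; rewrite /= ?mul1r ?mulr1. Qed.

(** On the right the factors come in the opposite order, whence the commutation
    hypothesis. *)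
Lemma smulA l a b v : GRing.comm a b ->
  smul l a (smul l b v) = smul l (a * b) v.
Proof. by move=> ab; case: l; rewrite /= -?mulrA // ab mulrA. Qed.

Lemma smulZl l c a v : smul l (c *: a) v = c *: smul l a v.
Proof. by case: l; rewrite /= -?scalerAl -?scalerAr. Qed.

Lemma smulZr l c a v : smul l a (c *: v) = c *: smul l a v.
Proof. by case: l; rewrite /= -?scalerAl -?scalerAr. Qed.

Lemma smul_suml l (I : finType) (F : I -> G) v :
  smul l (\sum_i F i) v = \sum_i smul l (F i) v.
Proof. by case: l; rewrite /= ?mulr_suml ?mulr_sumr. Qed.

Lemma smul_sumr l (I : finType) (F : I -> G) a :
  smul l a (\sum_i F i) = \sum_i smul l a (F i).
Proof. by case: l; rewrite /= ?mulr_suml ?mulr_sumr. Qed.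

Lemma ccoef_sum (I : finType) (F : I -> G) S :
  ccoef (\sum_i F i) S = \sum_i ccoef (F i) S.
Proof. by rewrite /ccoef sum_ffunE. Qed.

Lemma ccoef_smul l a v U :
  ccoef (smul l a v) U = \sum_T ccoef (smul l a (blade R T)) U * ccoef v T.
Proof.
rewrite {1}(cliff_sumE v) smul_sumr ccoef_sum; apply: eq_bigr => T _.
by rewrite smulZr ccoefZ mulrC.
Qed.

Definition scoef l s T U : R := ccoef (smul l (Bprod B s) (blade R T)) U.

Lemma ccoef_smul_torus l (w : 'I_n -> R) v U :
  ccoef (smul l (torus B w) v) U =
  \sum_s trig s w * ccoef (smul l (Bprod B s) v) U.
Proof.
rewrite torusE smul_suml ccoef_sum; apply: eq_bigr => s _.
by rewrite smulZl ccoefZ.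
Qed.

Lemma ccoef_smul_torusE l (w : 'I_n -> R) v U :
  ccoef (smul l (torus B w) v) U =
  \sum_s \sum_T trig s w * (scoef l s T U * ccoef v T).
Proof.
rewrite ccoef_smul_torus; apply: eq_bigr => s _.
by rewrite ccoef_smul mulr_sumr.
Qed.

Lemma trig_le1 (s : {ffun 'I_n -> bool}) (w : 'I_n -> R) : `|trig s w| <= 1.
Proof.
rewrite /trig normr_prod prodr_ile1 // => i _; rewrite normr_ge0 /= ler_norml.
by case: ifP => _; rewrite ?sin_geN1 ?sin_le1 ?cos_geN1 ?cos_le1.
Qed.

(** A bound of [ccoef (smul l (torus B w) v) U] that does not depend on [w]. *)
Definition smaj l (v : G) U : R := \sum_s \sum_T `|scoef l s T U| * `|ccoef v T|.

Lemma smul_torus_le l w v U : `|ccoef (smul l (torus B w) v) U| <= smaj l v U.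
Proof.
rewrite ccoef_smul_torusE; apply: le_trans (ler_norm_sum _ _ _) _.
apply: ler_sum => s _; apply: le_trans (ler_norm_sum _ _ _) _.
apply: ler_sum => T _; rewrite !normrM ler_piMl ?mulr_ge0 //.
exact: trig_le1.
Qed.

End SidedProduct.

Section SidedTransform.
Variables (R : realType) (n : nat).
Local Notation G := (clifford R (n + n)).
Local Notation B := (@bivec R n).
Local Notation L := (lebesgue R n).
Local Notation T := (rspace R n).
Local Notation c := (fscale R n).
Implicit Types (l : bool) (f g : T -> G) (x y z : T).

Definition mulc x y (i : 'I_n) : R := tnth x i * tnth y i.

Definition sfourier l f y : G :=
  cintegral (fun x => smul l (torus B (fun i => - mulc x y i)) (f x)).

Lemma cexp_biform x y :
  cexp (- biform x y) = torus B (fun i => - mulc x y i) :> G.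
Proof.
rewrite -(cexp_torus _ (@bivec_sq R n)); last exact: bivecC.
by congr cexp; rewrite /biform -sumrN; apply: eq_bigr => i _; rewrite scaleNr.
Qed.

Lemma fourierLE f : fourierL f = sfourier true f.
Proof.
apply/funext => y; rewrite /fourierL /sfourier; congr cintegral.
by apply/funext => x; rewrite cexp_biform.
Qed.

Lemma fourierRE f : fourierR f = sfourier false f.
Proof.
apply/funext => y; rewrite /fourierR /sfourier; congr cintegral.
by apply/funext => x; rewrite cexp_biform.
Qed.

Definition cintegrable f := forall S, integrableR L (fun x => ccoef (f x) S).

Lemma ccoef_cintegral f S : cintegrable f ->
  ccoef (cintegral f) S = c * \int[L]_x ccoef (f x) S.
Proof. by move=> intf; rewrite ccoefE Rintegral_fmeas. Qed.

Lemma ccoef_smul_cintegral l a f U : cintegrable f ->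
  ccoef (smul l a (cintegral f)) U = c * \int[L]_x ccoef (smul l a (f x)) U.
Proof.
move=> intf; rewrite ccoef_smul.
under [in RHS]eq_Rintegral do rewrite ccoef_smul.
rewrite Rintegral_sum; last by move=> S; exact: integrableRZ.
rewrite mulr_sumr; apply: eq_bigr => S _.
by rewrite ccoef_cintegral // RintegralZl // mulrCA.
Qed.

Lemma integrable_smaj l f U : cintegrable f ->
  integrableR L (fun x => smaj l (f x) U).
Proof.
move=> intf; apply: integrableR_sum => s; apply: integrableR_sum => S.
by apply: integrableRZ; exact: integrable_norm.
Qed.

(** The angles [w] and the argument of [f] are both functions of [t], so that this
    covers measurability in one variable and in two. *)
Lemma measurable_smul_torus d (X : measurableType d) l f U
    (w : X -> 'I_n -> R) (p : X -> T) :
  (forall i, measurable_fun setT (w^~ i)) -> measurable_fun setT p ->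
  cintegrable f ->
  measurable_fun setT (fun t => ccoef (smul l (torus B (w t)) (f (p t))) U).
Proof.
move=> mw mp intf; under eq_fun do rewrite ccoef_smul_torusE.
apply: measurable_sum => s; apply: measurable_sum => S.
apply: measurable_funM.
  apply: measurable_prod => i _; case: (s i).
    apply: (measurableT_comp _ (mw i)); apply: continuous_measurable_fun.
    exact: continuous_sin.
  apply: (measurableT_comp _ (mw i)); apply: continuous_measurable_fun.
  exact: continuous_cos.
apply: measurable_funM => //.
exact: (measurableT_comp (integrableR_measurable (intf S)) mp).
Qed.

Lemma measurable_mulc1 y i : measurable_fun setT (fun x => mulc x y i).
Proof.
by apply: measurable_funM => //; exact: measurable_tnth.
Qed.

Lemma measurable_mulc2 x i : measurable_fun setT (fun y => mulc x y i).
Proof.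
by apply: measurable_funM => //; exact: measurable_tnth.
Qed.

Lemma cintegrable_kernel l f y (w : T -> 'I_n -> R) :
  (forall i, measurable_fun setT (w^~ i)) -> cintegrable f ->
  cintegrable (fun x => smul l (torus B (w x)) (f x)).
Proof.
move=> mw intf U; apply: (integrableR_le _ _ (integrable_smaj l U intf)).
  exact: (@measurable_smul_torus _ T l f U w id).
by move=> x; exact: smul_torus_le.
Qed.

Definition laplaceN k y : R := \prod_i laplace (eps R k) (tnth y i).

Lemma integrable_laplaceN k : integrableR L (laplaceN k).
Proof.
apply: (lebesgue_integral_prod (g := fun=> laplace (eps R k)) _).1 => i.
by apply: integrable_laplace; exact: eps_gt0.
Qed.

Lemma laplaceN_gt0 k y : 0 < laplaceN k y.
Proof. by apply: prodr_gt0 => i _; exact: expR_gt0. Qed.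

Lemma laplaceN_le1 k y : laplaceN k y <= 1.
Proof.
apply: prodr_ile1 => i _; rewrite laplace_ge0 /= -expR0 ler_expR mulNr oppr_le0.
by rewrite mulr_ge0 // ltW // eps_gt0.
Qed.

Lemma laplaceN_cvg1 y : laplaceN ^~ y @ \oo --> (1 : R).
Proof.
have -> : (1 : R) = \prod_(i < n) 1 by rewrite big1.
apply: cvg_big => [|i _]; first exact: mul_continuous.
have e0 : (fun k => - eps R k * `|tnth y i|) @ \oo --> (0 : R).
  rewrite -(mul0r `|tnth y i|); apply: cvgMr_tmp; rewrite -oppr0.
  by apply: cvgN; exact: cvg_harmonic.
rewrite -[X in _ --> X]expR0.
exact: (cvg_comp _ _ e0 (@continuous_expR R 0)).
Qed.

Lemma trig_laplace k s (u : 'I_n -> R) :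
  integrableR L (fun y => laplaceN k y * trig s (fun i => u i * tnth y i)) /\
  \int[L]_y (laplaceN k y * trig s (fun i => u i * tnth y i)) =
  \prod_i (if s i then 0 else 2 * eps R k / (eps R k ^+ 2 + u i ^+ 2)).
Proof.
pose g i (t : measurableTypeR R) :=
  laplace (eps R k) t * (if s i then sin (u i * t) else cos (u i * t)).
have ig i : integrableR (@lebesgue_measure R) (g i).
  rewrite /g; case: (s i).
    by apply: integrable_laplace_sin; exact: eps_gt0.
  by apply: integrable_laplace_cos; exact: eps_gt0.
have [iP EP] := lebesgue_integral_prod ig.
have E y : laplaceN k y * trig s (fun i => u i * tnth y i) = \prod_i g i (tnth y i).
  by rewrite /laplaceN /trig -big_split.
split; first by under eq_fun do rewrite E.
under eq_Rintegral do rewrite E.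
rewrite EP; apply: eq_bigr => i _; rewrite /g; case: (s i).
  by rewrite Rintegral_laplace_sin ?eps_gt0.
by rewrite Rintegral_laplace_cos ?eps_gt0.
Qed.

(** Integration against an even weight kills the coordinates of the kernel that
    contain a sine.  What survives is the product of the cosines, a scalar: its
    integral is the Poisson kernel, on whichever side it acts. *)
Lemma kernel_laplace l k x z v U :
  c * c * \int[L]_y (laplaceN k y *
    ccoef (smul l (torus B (fun i => (tnth x i - tnth z i) * tnth y i)) v) U) =
  poissonN k x z * ccoef v U.
Proof.
pose u i : R := tnth x i - tnth z i.
under eq_Rintegral do rewrite ccoef_smul_torus mulr_sumr.
under eq_Rintegral => y _.
  under eq_bigr do rewrite mulrA mulrC.
  over.
rewrite Rintegral_sum => [|s]; last first.
  exact: integrableRZ (trig_laplace k s u).1.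
pose s0 : {ffun 'I_n -> bool} := [ffun=> false].
rewrite (bigD1 s0) //= big1 => [|s ss0]; last first.
  rewrite RintegralZl //; last exact: (trig_laplace k s u).1.
  rewrite (trig_laplace k s u).2; have [i si] : exists i, s i.
    apply/existsP; apply: contraNT ss0 => /existsPn h; apply/eqP/ffunP => i.
    by rewrite ffunE; apply/negbTE/h.
  by rewrite (bigD1 i) //= si mul0r mulr0.
rewrite addr0 RintegralZl //; last exact: (trig_laplace k s0 u).1.
rewrite (trig_laplace k s0 u).2.
have -> : Bprod B s0 = 1 by rewrite /Bprod big1 // => i _; rewrite ffunE.
rewrite smul1 mulrCA mulrC fscale_sq; congr (_ * _).
rewrite -[n in _ ^+ n]card_ord -prodr_const -prodfV -big_split.
apply: eq_bigr => i _; rewrite ffunE /poisson -/(u i) /=.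
have p0 : (pi : R) != 0 by rewrite gt_eqF ?pi_gt0.
have d0 : eps R k ^+ 2 + u i ^+ 2 != 0.
  by rewrite gt_eqF // ltr_pwDl ?exprn_gt0 ?eps_gt0 ?sqr_ge0.
by move: (pi : R) p0 => p p0; field; rewrite d0 p0.
Qed.

Section Inversion.
Variables (l : bool) (f : T -> G).
Hypothesis intf : cintegrable f.

Lemma torus_comm (a b : 'I_n -> R) : GRing.comm (torus B a) (torus B b).
Proof.
rewrite /GRing.comm !torusM; do ?exact: bivec_sq; do ?exact: bivecC.
by rewrite /torus; apply: eq_bigr => i _; rewrite addrC.
Qed.

Lemma cintegrable_shift x y : cintegrable (fun z =>
  smul l (torus B (fun i => (tnth x i - tnth z i) * tnth y i)) (f z)).
Proof.
apply: cintegrable_kernel => // i; apply: measurable_funM => //.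
by apply: measurable_funB => //; exact: measurable_tnth.
Qed.

(** The kernel is a character: its values at [x] and at [- z] multiply to its value
    at [x - z]. *)
Lemma ccoef_smul_sfourier x y U :
  ccoef (smul l (torus B (mulc x y)) (sfourier l f y)) U =
  c * \int[L]_z ccoef
    (smul l (torus B (fun i => (tnth x i - tnth z i) * tnth y i)) (f z)) U.
Proof.
rewrite ccoef_smul_cintegral; last first.
  by apply: cintegrable_kernel => // i; apply: measurableT_comp => //;
     exact: measurable_mulc1.
apply: (congr1 ( *%R c)); apply: eq_Rintegral => z _.
rewrite smulA; last exact: torus_comm.
rewrite torusM; [|exact: bivec_sq|exact: bivecC].
by congr (ccoef (smul l _ _) U); rewrite /torus; apply: eq_bigr => i _;
   rewrite /mulc mulrBl.
Qed.

Let F U x k y z := laplaceN k y * ccoef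
  (smul l (torus B (fun i => (tnth x i - tnth z i) * tnth y i)) (f z)) U.

Let mF U x k : measurable_fun setT (fun p : T * T => F U x k p.1 p.2).
Proof.
apply: measurable_funM.
  exact: (measurableT_comp (integrableR_measurable (integrable_laplaceN k))
    measurable_fst).
apply: measurable_smul_torus => // i; apply: measurable_funM.
  apply: measurable_funB => //.
  exact: (measurableT_comp (measurable_tnth i) measurable_snd).
exact: (measurableT_comp (measurable_tnth i) measurable_fst).
Qed.

Let Fle U x k y z : `|F U x k y z| <= laplaceN k y * smaj l (f z) U.
Proof.
rewrite /F normrM gtr0_norm ?laplaceN_gt0 // ler_wpM2l ?smul_torus_le //.
exact/ltW/laplaceN_gt0.
Qed.

Lemma integrable_laplace_sfourier x k U : integrableR L (fun y =>
  laplaceN k y * ccoef (smul l (torus B (mulc x y)) (sfourier l f y)) U).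
Proof.
have := integrableRZ c (integrable_Rintegral (@mF U x k) (@Fle U x k)
  (integrable_laplaceN k) (integrable_smaj l U intf)).
congr (_.-integrable _ (EFin \o _)); apply/funext => y.
rewrite ccoef_smul_sfourier mulrCA; apply: (congr1 ( *%R c)).
by rewrite /F RintegralZl //; exact: cintegrable_shift.
Qed.

(** Abel means of the inverse transform are Poisson smoothings of [f], by Fubini's
    theorem. *)
Lemma laplace_sfourier x k U :
  c * \int[L]_y (laplaceN k y *
    ccoef (smul l (torus B (mulc x y)) (sfourier l f y)) U) =
  smooth (fun z => ccoef (f z) U) k x.
Proof.
transitivity (c * \int[L]_y (c * \int[L]_z F U x k y z)).
  apply: (congr1 ( *%R c)); apply: eq_Rintegral => y _.
  rewrite ccoef_smul_sfourier mulrCA; apply: (congr1 ( *%R c)).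
  by rewrite /F RintegralZl //; exact: cintegrable_shift.
rewrite RintegralZl //; last first.
  exact: (integrable_Rintegral (@mF U x k) (@Fle U x k)
    (integrable_laplaceN k) (integrable_smaj l U intf)).
rewrite (Rintegral_swap (@mF U x k) (@Fle U x k) (integrable_laplaceN k)
  (integrable_smaj l U intf)) mulrA.
have c0 : c * c != 0 by rewrite mulf_neq0 ?gt_eqF ?fscale_gt0.
under eq_Rintegral => z _.
  rewrite (_ : \int[L]_y F U x k y z =
    (c * c)^-1 * (poissonN k x z * ccoef (f z) U)); last first.
    by rewrite -(kernel_laplace l) (mulKf c0).
  over.
by rewrite RintegralZl ?(mulVKf c0) //; exact: integrable_poissonN.
Qed.

(** At [x = 0] the kernel is [1], so the weighted transform is measurable as an
    integral depending on a parameter; dividing by the weight gives the result. *)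
Lemma measurable_sfourier U :
  measurable_fun setT (fun y => ccoef (sfourier l f y) U).
Proof.
pose o : T := [tuple 0 | i < n].
have E y : ccoef (sfourier l f y) U =
    (\prod_i expR (eps R 0 * `|tnth y i|)) * (laplaceN 0 y *
    ccoef (smul l (torus B (mulc o y)) (sfourier l f y)) U).
  rewrite mulrA -big_split [X in X * _]big1 => [|i _]; last first.
    by rewrite /= -expRD mulNr subrr expR0.
  rewrite mul1r (_ : torus B _ = 1) ?smul1 //.
  by rewrite /torus big1 // => i _; rewrite /mulc tnth_mktuple mul0r rot0.
under eq_fun do rewrite E.
apply: measurable_funM.
  apply: (measurable_prod_tnth
    (g := fun=> fun t : R => expR (eps R 0 * `|t|))) => i.
  apply: continuous_measurable_fun => t.
  apply: (@continuous_comp _ _ _ (fun t => eps R 0 * `|t|) expR).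
    by apply: continuous_comp; [exact: norm_continuous|exact: mulrl_continuous].
  exact: continuous_expR.
exact: integrableR_measurable (integrable_laplace_sfourier o 0 U).
Qed.

Lemma laplace_smul_le x k y U :
  `|laplaceN k y * ccoef (smul l (torus B (mulc x y)) (sfourier l f y)) U| <=
  smaj l (sfourier l f y) U.
Proof.
rewrite normrM gtr0_norm ?laplaceN_gt0 //.
exact: le_trans (ler_piMl (normr_ge0 _) (laplaceN_le1 _ _)) (smul_torus_le _ _ _ _).
Qed.

Hypothesis intFf : cintegrable (sfourier l f).

Lemma sfourier2_ropp x U :
  ccoef (sfourier l (sfourier l f) (ropp x)) U =
  c * \int[L]_y ccoef (smul l (torus B (mulc x y)) (sfourier l f y)) U.
Proof.
have E y : torus B (fun i => - mulc y (ropp x) i) = torus B (mulc x y).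
  by apply: eq_bigr => i _; rewrite /mulc tnth_mktuple mulrN opprK mulrC.
rewrite ccoef_cintegral => [|V].
  by apply: (congr1 ( *%R c)); apply: eq_Rintegral => y _; rewrite E.
under eq_fun do rewrite E.
apply: cintegrable_kernel => //; exact: measurable_mulc2.
Qed.

(** The weights increase to [1] and the transform of [f] is integrable: dominated
    convergence holds at every point [x]. *)
Lemma smooth_cvg_sfourier2 x U :
  (fun k => smooth (fun z => ccoef (f z) U) k x) @ \oo -->
  ccoef (sfourier l (sfourier l f) (ropp x)) U.
Proof.
rewrite sfourier2_ropp; under eq_fun do rewrite -laplace_sfourier.
have mK : measurable_fun setT
    (fun y => ccoef (smul l (torus B (mulc x y)) (sfourier l f y)) U).
  apply: (@measurable_smul_torus _ T l _ U (mulc x) id) => //.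
  exact: measurable_mulc2.
apply: cvgMl_tmp.
apply: (Rintegral_dominated_cvg (u := fun y => smaj l (sfourier l f y) U)) => //.
- by move=> k; exact: integrableR_measurable (integrable_laplace_sfourier x k U).
- move=> y; rewrite -[X in _ --> X]mul1r; apply: cvgMr_tmp.
  exact: laplaceN_cvg1.
- exact: integrable_smaj.
- by move=> k y; exact: laplace_smul_le.
Qed.

Lemma smooth_bounded U : exists M, forall k x,
  `|smooth (fun z => ccoef (f z) U) k x| <= M.
Proof.
exists (c * \int[L]_y smaj l (sfourier l f y) U) => k x.
rewrite -laplace_sfourier normrM gtr0_norm ?fscale_gt0 //.
rewrite ler_wpM2l ?(ltW (fscale_gt0 _ _)) //.
apply: le_norm_Rintegral.
- exact: integrable_laplace_sfourier.
- exact: integrable_smaj.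
- by move=> y; exact: laplace_smul_le.
Qed.

End Inversion.
End SidedTransform.

(** * Inversion for Lebesgue measurable functions *)

Section IntegrableClass.
Variables (R : realType) (n : nat).
Local Notation G := (clifford R (n + n)).
Local Notation L := (lebesgue R n).
Local Notation T := (rspace R n).
Implicit Types (l : bool) (f g : T -> G).

Lemma ccoef_le_cnorm (v : G) S : `|ccoef v S| <= cnorm v.
Proof.
rewrite /cnorm -sqrtr_sqr ler_sqrt; last by apply: sumr_ge0 => U _; exact: sqr_ge0.
by rewrite (bigD1 S) //= lerDl; apply: sumr_ge0 => U _; exact: sqr_ge0.
Qed.

Lemma cintegrable_of_cnorm f g (N : set T) :
  measurable N -> L N = 0%E -> (forall x, ~ N x -> f x = g x) ->
  (forall S, measurable_fun setT (fun x => ccoef (g x) S)) ->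
  (\int[fmeas R n]_x (cnorm (f x))%:E < +oo)%E -> cintegrable g.
Proof.
move=> mN N0 fg mg foo S; apply/integrable_fmeas/integrableP; split.
  exact/measurable_EFinP.
apply: le_lt_trans foo.
apply: (ge0_le_integral_off_null mN (fmeas_null N0)) => // x.
- by rewrite lee_fin sqrtr_ge0.
- by move=> Nx; rewrite lee_fin fg //; exact: ccoef_le_cnorm.
Qed.

(** Transforms are defined by integrals, so a function of class [L1] may be replaced
    by a Borel function equal to it almost everywhere. *)
Lemma L1_borel f : L1 f -> exists g, cintegrable g /\
  exists N, [/\ measurable N, L N = 0%E & forall x, ~ N x -> f x = g x].
Proof.
move=> [mf foo].
have [g gP] := choice (fun S => completed_measurableP (mf S)).
have [N NP] := choice (fun S => (gP S).2).
have [mN N0] : measurable [set x | exists S, N S x] /\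
    L [set x | exists S, N S x] = 0%E.
  by apply: fin_bigcup_null => S; have [] := NP S.
pose g' x : G := [ffun S => g S x].
have fg x : ~ [set x | exists S, N S x] x -> f x = g' x.
  move=> Nx; apply/cliffP => S; rewrite ccoefE; have [_ _ ->//] := NP S.
  by apply: contra_not Nx => NS; exists S.
exists g'; split; last by exists [set x | exists S, N S x].
apply: (cintegrable_of_cnorm mN N0 fg) => // S.
by under eq_fun do rewrite ccoefE; exact: (gP S).1.
Qed.

Lemma sfourier_off_null l f g (N : set T) :
  measurable N -> L N = 0%E -> (forall x, ~ N x -> f x = g x) ->
  sfourier l f = sfourier l g.
Proof.
move=> mN N0 fg; apply/funext => y; apply/cliffP => S; rewrite !ccoefE /Rintegral.
congr fine; apply: (integral_off_null mN (fmeas_null N0)) => x Nx.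
by rewrite fg.
Qed.

Lemma L1_sfourier l g : cintegrable g -> L1 (sfourier l g) ->
  cintegrable (sfourier l g).
Proof.
move=> intg [_ oo].
apply: (cintegrable_of_cnorm measurable0 (measure0 L) _ _ oo) => // S.
exact: measurable_sfourier.
Qed.

Lemma sfourier_inversion l f : L1 f -> L1 (sfourier l f) ->
  {ae fmeas R n, forall x, f x = sfourier l (sfourier l f) (ropp x)}.
Proof.
move=> /L1_borel[g [intg [N [mN N0 fg]]]].
rewrite (sfourier_off_null l mN N0 fg) => /(L1_sfourier intg) intFg.
have gh S : exists M, [/\ measurable M, L M = 0%E & forall x, ~ M x ->
    ccoef (g x) S = ccoef (sfourier l (sfourier l g) (ropp x)) S].
  have [M hM] := smooth_bounded intg intFg S.
  apply: (@smooth_limit_ae _ _ _ _ M) => // x.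
  exact: smooth_cvg_sfourier2.
have [M MP] := choice gh.
have [mM M0] : measurable [set x | exists S, M S x] /\
    L [set x | exists S, M S x] = 0%E.
  by apply: fin_bigcup_null => S; have [] := MP S.
exists (N `|` [set x | exists S, M S x]); split.
- exact: measurableU.
- by apply: fmeas_null; exact: null_set_setU.
- move=> x /= fx; apply: contrapT => /not_orP[Nx Mx]; apply: fx.
  rewrite fg //; apply/cliffP => S; have [_ _ ->//] := MP S.
  by apply: contra_not Mx => MS; exists S.
Qed.

(** Both sides are limits of the same smoothings of [f]. *)
Lemma sfourier2_side f l l' : L1 f -> L1 (sfourier l f) -> L1 (sfourier l' f) ->
  sfourier l (sfourier l f) =1 sfourier l' (sfourier l' f).
Proof.
move=> /L1_borel[g [intg [N [mN N0 fg]]]].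
rewrite !(fun l => sfourier_off_null l mN N0 fg).
move=> /(L1_sfourier intg) il /(L1_sfourier intg) il' y.
have <- : ropp (ropp y) = y.
  by apply: eq_from_tnth => i; rewrite !tnth_mktuple opprK.
apply/cliffP => S.
have cl := @smooth_cvg_sfourier2 _ _ l g intg il (ropp y) S.
have cl' := @smooth_cvg_sfourier2 _ _ l' g intg il' (ropp y) S.
exact: cvg_unique cl cl'.
Qed.

End IntegrableClass.

Theorem mainTheorem8 (R : realType) (n : nat)
    (f : rspace R n -> clifford R (n + n)) (hf : L1 f) :
  (L1 (fourierL f) ->
     {ae fmeas R n, forall x, f x = fourierL (fourierL f) (ropp x)}) /\
  (L1 (fourierR f) ->
     {ae fmeas R n, forall x, f x = fourierR (fourierR f) (ropp x)}) /\
  (L1 (fourierL f) -> L1 (fourierR f) ->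
     fourierL (fourierL f) =1 fourierR (fourierR f)).
Proof.
rewrite !fourierLE !fourierRE; split; last split.
- exact: sfourier_inversion.
- exact: sfourier_inversion.
- exact: sfourier2_side.
Qed.
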